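(* Let $(\lambda,\lambda',\lambda'')$ be a regular triple of weights and put $\lambda_1=\lambda$, $\lambda_2=\lambda'$, $\lambda_3=\lambda''$, $\lambda_0=\lambda\lambda'\lambda''$, $\lambda_4=\lambda\lambda'$, $\lambda_5=\lambda'\lambda''$. Consider $$\mathbf T_{\lambda_1,\lambda_2,\lambda_3}:M_{\lambda_4,\lambda_3}^{\lambda_0}\otimes M_{\lambda_1,\lambda_2}^{\lambda_4}\to M_{\lambda_2,\lambda_3}^{\lambda_5}\otimes M_{\lambda_1,\lambda_5}^{\lambda_0},\qquad \mathbf T_{\lambda_2,\lambda_3,\lambda_0^*}:M_{\lambda_5,\lambda_0^*}^{\lambda_1^*}\otimes M_{\lambda_2,\lambda_3}^{\lambda_5}\to M_{\lambda_3,\lambda_0^*}^{\lambda_4^*}\otimes M_{\lambda_2,\lambda_4^*}^{\lambda_1^*}.$$ Then $\mathbf T_{\lambda_2,\lambda_3,\lambda_0^*}$ written this way makes sense as a $\mathbf T$ map (i.e. $(\lambda_2,\lambda_3,\lambda_0^* )$ is a regular triple with $\lambda_2\lambda_3=\lambda_5$, $\lambda_3\lambda_0^*=\lambda_4^*$, $\lambda_2\lambda_3\lambda_0^*=\lambda_1^*$), and $$(\mathbf T_{\lambda_2,\lambda_3,\lambda_0^*})_{12}\,(\mathbf A_{\lambda_1,\lambda_5}^{\lambda_0})_1\,(\mathbf T_{\lambda_1,\lambda_2,\lambda_3})_{21}=(\mathbf A_{\lambda_4,\lambda_3}^{\lambda_0})_1\,(\mathbf A_{\lambda_1,\lambda_2}^{\lambda_4})_2\,\mathbf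 P_{(12)}$$ as maps $M_{\lambda_1,\lambda_2}^{\lambda_4}\otimes M_{\lambda_4,\lambda_3}^{\lambda_0}\to M_{\lambda_3,\lambda_0^*}^{\lambda_4^*}\otimes M_{\lambda_2,\lambda_4^*}^{\lambda_1^*}$, where $\mathbf P_{(12)}$ is the map exchanging the two tensor factors.
   Context: $N$ is a fixed odd positive integer, $q=e^{\pi\sqrt{-1}/N}$. $\mathcal W$ is the Hopf algebra over $\mathbb C$ generated by $X^{\pm1},Y$ with $XY=q^2YX$, $\Delta X=X\otimes X$, $\Delta Y=Y\otimes X+1\otimes Y$, $\epsilon(X)=1$, $\epsilon(Y)=0$, $S(X)=X^{-1}$, $S(Y)=-YX^{-1}$. Representations are finite dimensional complex left $\mathcal W$-modules; tensor products are formed via $\Delta$; a representation is trivial if each $W$ acts by $\epsilon(W)\,\mathrm{id}$. $e_0,\dots,e_{N-1}$ is the standard basis of $\mathbb C^N$, indices mod $N$; $Ae_k=q^{2k}e_k$, $Be_k=e_{k+1}$. For each $z\in\mathbb C^\times$ an $N$-th root $z^{1/N}$ is fixed, with $1^{1/N}=1$, $(z^{1/N})^{-1}=(z^{-1})^{1/N}=:z^{-1/N}$, $(-z)^{1/N}=-z^{1/N}$; $m_{z,w}\in\{0,\dots,N-1\}$ is defined by $(zw)^{1/N}=q^{2m_{z,w}}z^{1/N}w^{1/N}$. Subscripts on operators indicate the tensor factors acted on ($A_2=\mathrm{id}\otimes A$ etc.; $O_{ij}$ means a two-factor operator $O$ applied with its first slot at factor $i$ and its second slot at factor $j$). A weight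 is a pair $\lambda=(x,y)\in\mathbb C^2$, non-singular if $x,y\neq0$. Product: $(x,y)(x',y')=(xx',yx'+y')$. For non-singular $\lambda=(x,y)$: $\lambda^*=(x^{-1},-yx^{-1})$ and $V_\lambda$ is $\mathbb C^N$ with $X$ acting by $x^{1/N}A$, $Y$ by $y^{1/N}B$. A sequence of non-singular weights $(\lambda_1,\dots,\lambda_n)$ is regular if $X,Y$ act invertibly on $V_{\lambda_i}\otimes\cdots\otimes V_{\lambda_j}$ for all $i\le j$ (equivalently all products $\lambda_i\cdots\lambda_j$ are non-singular). For a regular pair, $M^{\lambda\lambda'}_{\lambda,\lambda'}$ denotes $\mathbb C^N$ as a trivial representation. For $\mathbf a,\mathbf c\in\mathbb C$ with $\mathbf c^N-\mathbf a^N=1$ put $w(\mathbf a,\mathbf c|0)=1$, $w(\mathbf a,\mathbf c|n)=\prod_{j=1}^n(\mathbf c-\mathbf a q^{2j})^{-1}$ ($N$-periodic in $n$). For an operator $C$ with $C^N=\mathrm{id}$, $\Phi^q_{\mathbf a,\mathbf c}(C)$ acts on the $q^{2i}$-eigenspace of $C$ by $\zeta_{\mathbf a,\mathbf c}w(\mathbf a,\mathbf c|i)$, with $\zeta_{\mathbf a,\mathbf c}$ a fixed nonzero constant. For a regular pair $\lambda=(x,y),\lambda'=(x',y')$, $\mathbf F_{\lambda,\lambda'}=B_2^{-m_{x,x'}}\,\mathbf S\,\Phi^q_{\mathbf a,\mathbf c}(B_1A_2B_2^{-1})$, where $\mathbf S(e_i\otimes e_j)=e_i\otimes e_{i+j}$,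 $\mathbf a=-\frac{y^{1/N}(x')^{1/N}}{(yx'+y')^{1/N}}$, $\mathbf c=\frac{(y')^{1/N}}{(yx'+y')^{1/N}}$; it is a $\mathcal W$-isomorphism $V_\lambda\otimes V_{\lambda'}\to M^{\lambda\lambda'}_{\lambda,\lambda'}\otimes V_{\lambda\lambda'}$. For a regular triple, $\mathbf T_{\lambda,\lambda',\lambda''}: M^{\lambda\lambda'\lambda''}_{\lambda\lambda',\lambda''}\otimes M^{\lambda\lambda'}_{\lambda,\lambda'}\to M^{\lambda'\lambda''}_{\lambda',\lambda''}\otimes M^{\lambda\lambda'\lambda''}_{\lambda,\lambda'\lambda''}$ is the unique invertible linear map with $(\mathbf F_{\lambda,\lambda'\lambda''})_{13}(\mathbf F_{\lambda',\lambda''})_{23}(\mathbf F_{\lambda,\lambda'})_{12}^{-1}(\mathbf F_{\lambda\lambda',\lambda''})_{23}^{-1}=(\mathbf T_{\lambda,\lambda',\lambda''})_{21}$ on $\mathbb C^N\otimes\mathbb C^N\otimes\mathbb C^N$. For non-singular $\lambda=(x,y)$ define on $\mathbb C^N$: $C_\lambda e_i=q^{-2i\,m_{y,x^{-1}}}q^{-i(i-1)}e_{-i}$, $D_\lambda e_i=q^{-2i\,m_{y,x^{-1}}}q^{i(i-1)}e_{-i}$. For a regular pair let $I^{\lambda\lambda'}_{\lambda,\lambda'}:M^{\lambda\lambda'}_{\lambda,\lambda'}\to\mathrm{Hom}_{\mathcal W}(V_{\lambda\lambda'},V_\lambda\otimes V_{\lambda'})$ be the isomorphism $(I^{\lambda\lambda'}_{\lambda,\lambda'}f)(v)=\mathbf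 F^{-1}_{\lambda,\lambda'}(f\otimes v)$. Let $\mathbf A^{\mathrm{Hom}}:\mathrm{Hom}_{\mathcal W}(V_{\lambda\lambda'},V_\lambda\otimes V_{\lambda'})\to\mathrm{Hom}_{\mathcal W}(V_{\lambda^*},V_{\lambda'}\otimes V_{(\lambda\lambda')^*})$ be the isomorphism sending $f$ to the $g$ determined by $\sum_j e_j\otimes g(e_j)=(D_{\lambda^*}\otimes\mathrm{id}\otimes C_{\lambda\lambda'})\big(\sum_j f(e_j)\otimes e_j\big)$. Then $\mathbf A^{\lambda\lambda'}_{\lambda,\lambda'}:=(I^{\lambda^*}_{\lambda',(\lambda\lambda')^*})^{-1}\circ\mathbf A^{\mathrm{Hom}}\circ I^{\lambda\lambda'}_{\lambda,\lambda'}:M^{\lambda\lambda'}_{\lambda,\lambda'}\to M^{\lambda^*}_{\lambda',(\lambda\lambda')^*}$ (here $\lambda'(\lambda\lambda')^*=\lambda^*$). *)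

(* Defs.v *)
From HB Require Import structures.
From mathcomp Require Import all_boot all_order all_algebra.
From mathcomp Require Import complex.
From mathcomp Require Import all_classical all_reals all_analysis.
Set Implicit Arguments.
Unset Strict Implicit.
Unset Printing Implicit Defensive.
Import Order.TTheory GRing.Theory Num.Theory.
Local Open Scope ring_scope.
Local Open Scope complex_scope.

(* N = p.+1, so that 'I_p.+1 carries its group structure Z/N (also for N = 1,
   which 'Z_N would not allow).  A tensor product of copies of C^N is the space
   of complex functions on a product of index types. *)

Section Tensors.
Variable R : realType.

Definition vec (I : finType) := {ffun I -> R[i]^o}.

Definition bas (I : finType) (i : I) : vec I := [ffun j => (j == i)%:R].

Definition tens (I J : finType) (u : vec I) (v : vec J) : vec (I * J)%type :=
  [ffun k => u k.1 * v k.2].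

Section OnBasis.
Variables (I : finType) (U : vectType R[i]) (f : I -> U).

Definition on_basis_fun (v : vec I) : U := \sum_i v i *: f i.

Fact on_basis_fun_linear : linear on_basis_fun.
Proof.
move=> a u v; rewrite /on_basis_fun scaler_sumr -big_split /=.
by apply: eq_bigr => i _; rewrite !ffunE scalerDl scalerA.
Qed.
HB.instance Definition _ := GRing.isLinear.Build R[i] (vec I) U *:%R
  on_basis_fun on_basis_fun_linear.

Definition on_basis : 'Hom(vec I, U) := linfun on_basis_fun.
End OnBasis.

(* O acting on the tensor factors of index k : K that are read by get and
   overwritten by put, and as the identity on the other factors. *)
Section Leg.
Variables (K I : finType) (get : K -> I) (put : I -> K -> K).
Variable O : 'End(vec I).

Definition leg_fun (v : vec K) : vec K :=
  [ffun k => O [ffun a => v (put a k)] (get k)].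

Fact leg_fun_linear : linear leg_fun.
Proof.
move=> a u v; apply/ffunP => k; rewrite !ffunE.
have -> : [ffun b => (a *: u + v) (put b k)] =
  a *: [ffun b => u (put b k)] + [ffun b => v (put b k)] :> vec I.
  by apply/ffunP => b; rewrite !ffunE.
by rewrite linearP !ffunE.
Qed.
HB.instance Definition _ := GRing.isLinear.Build R[i] (vec K) (vec K) *:%R
  leg_fun leg_fun_linear.

Definition leg : 'End(vec K) := linfun leg_fun.
End Leg.

(* O_1 and O_2 on two factors.  As I * I * I is (I * I) * I, at1 also gives
   O_12 on three factors when O acts on two. *)
Definition at1 {I J : finType} : 'End(vec I) -> 'End(vec (I * J)%type) :=
  leg fst (fun a k => (a, k.2)).
Definition at2 {I J : finType} : 'End(vec J) -> 'End(vec (I * J)%type) :=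
  leg snd (fun b k => (k.1, b)).

Definition at21 (I : finType) :
    'End(vec (I * I)%type) -> 'End(vec (I * I)%type) :=
  leg (fun k => (k.2, k.1)) (fun ab _ => (ab.2, ab.1)).

Definition at12_3 (I : finType) :
    'End(vec (I * I)%type) -> 'End(vec (I * I * I)%type) :=
  at1.
Definition at21_3 (I : finType) (O : 'End(vec (I * I)%type)) :
    'End(vec (I * I * I)%type) := at12_3 (at21 O).
Definition at13_3 (I : finType) :
    'End(vec (I * I)%type) -> 'End(vec (I * I * I)%type) :=
  leg (fun k => (k.1.1, k.2)) (fun ab k => (ab.1, k.1.2, ab.2)).
Definition at23_3 (I : finType) :
    'End(vec (I * I)%type) -> 'End(vec (I * I * I)%type) :=
  leg (fun k => (k.1.2, k.2)) (fun ab k => (k.1.1, ab.1, ab.2)).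

Definition tensop (I J : finType) (f : 'End(vec I)) (g : 'End(vec J)) :
    'End(vec (I * J)%type) := (at1 f \o at2 g)%VF.

Definition swap (I : finType) : 'End(vec (I * I)%type) :=
  on_basis (fun ab => bas (ab.2, ab.1)).

Definition lfun_exp (I : finType) (f : 'End(vec I)) (m : nat) : 'End(vec I) :=
  iter m (comp_lfun f) \1%VF.

End Tensors.

Section Maps.
Variables (R : realType) (p : nat).
Local Notation C := R[i].
Local Notation N := p.+1.
Local Notation V := (vec R 'I_N).
Local Notation VV := (vec R ('I_N * 'I_N)%type).

Definition q : C := cos (pi / N%:R) +i* sin (pi / N%:R).

(* rt z stands for the fixed root z^{1/N}; its value at 0 is irrelevant. *)
Definition root_choice (rt : C -> C) : Prop :=
  [/\ forall z, z != 0 -> rt z ^+ N = z,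
      rt 1 = 1,
      forall z, z != 0 -> (rt z)^-1 = rt z^-1 &
      forall z, z != 0 -> rt (- z) = - rt z].

Variables (rt : C -> C) (zeta : C -> C -> C).

(* m_{z,w}; the default of odflt is only used for z or w equal to 0. *)
Definition mroot (z w : C) : 'I_N :=
  odflt ord0 [pick m : 'I_N | rt (z * w) == q ^+ (2 * m) * rt z * rt w].

Definition opA : 'End(V) := on_basis (fun k : 'I_N => q ^+ (2 * k) *: @bas R 'I_N k).
Definition opB : 'End(V) := on_basis (fun k : 'I_N => @bas R 'I_N (k + inZp 1)).

Definition weight : Type := (C * C)%type.
Definition nonsingular (l : weight) := (l.1 != 0) && (l.2 != 0).
Definition wmul (l l' : weight) : weight := (l.1 * l'.1, l.2 * l'.1 + l'.2).
Definition wdual (l : weight) : weight := (l.1^-1, - (l.2 * l.1^-1)).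

(* The operators by which the generators X and Y of the Hopf algebra
   (XY = q^2 YX, X invertible) act on a representation.  The relations are not
   recorded; they hold for repV l when l is non-singular, and for the tensor
   products of such representations. *)
Record rep := Rep {
  idx : finType;
  actX : 'End(vec R idx);
  actY : 'End(vec R idx) }.

Definition repV (l : weight) : rep :=
  @Rep 'I_N (rt l.1 *: opA) (rt l.2 *: opB).

(* Delta X = X (x) X and Delta Y = Y (x) X + 1 (x) Y. *)
Definition rep_tens (r s : rep) : rep :=
  @Rep (idx r * idx s)%type
    (tensop (actX r) (actX s))
    (tensop (actY r) (actX s) + tensop \1%VF (actY s)).

Definition acts_invertibly (r : rep) : Prop :=
  bijective (actX r) /\ bijective (actY r).

(* The nonempty infixes l :: t of s are its segments
   lambda_i, ..., lambda_j with i <= j. *)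
Definition regular (s : seq weight) : Prop :=
  all nonsingular s /\
  forall (l : weight) (t : seq weight), infix (l :: t) s ->
    acts_invertibly (foldl rep_tens (repV l) [seq repV l' | l' <- t]).

Definition wfun (a c : C) (n : nat) : C :=
  \prod_(1 <= j < n.+1) (c - a * q ^+ (2 * j))^-1.

(* When O^N = id, the whole space is the direct sum of the q^{2i}-eigenspaces
   of O, so that exactly one operator f satisfies the description. *)
Definition Phi (a c : C) (I : finType) (O : 'End(vec R I)) : 'End(vec R I) :=
  xget 0 [set f : 'End(vec R I) | forall (i : 'I_N) (v : vec R I),
    O v = q ^+ (2 * i) *: v -> f v = (zeta a c * wfun a c i) *: v]%classic.

Definition opS : 'End(VV) :=
  on_basis (fun ij => @bas R ('I_N * 'I_N)%type (ij.1, ij.1 + ij.2)).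

Definition Fmap (l l' : weight) : 'End(VV) :=
  let: (x, y) := l in let: (x', y') := l' in
  let d : C := rt (y * x' + y') in
  let a : C := - (rt y * rt x' / d) in
  let c : C := rt y' / d in
  (at2 (lfun_exp opB^-1 (mroot x x')) \o
   (opS \o Phi a c (at1 opB \o (at2 opA \o at2 opB^-1))))%VF.

(* at21_3 is injective, so that at most one T satisfies the description; one
   does for every regular triple. *)
Definition Tmap (l l' l'' : weight) : 'End(VV) :=
  xget 0 [set T : 'End(VV) | bijective T /\
    (at13_3 (Fmap l (wmul l' l'')) \o
     (at23_3 (Fmap l' l'') \o
      (at12_3 (Fmap l l')^-1 \o at23_3 (Fmap (wmul l l') l'')^-1)))%VF
    = at21_3 T]%classic.

(* q^{i(i-1)} depends only on i mod N because N is odd. *)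
Definition opC (l : weight) : 'End(V) :=
  on_basis (fun i : 'I_N =>
    (q ^- (2 * i * mroot l.2 l.1^-1) * q ^- (i * i.-1)) *: @bas R 'I_N (- i)).
Definition opD (l : weight) : 'End(V) :=
  on_basis (fun i : 'I_N =>
    (q ^- (2 * i * mroot l.2 l.1^-1) * q ^+ (i * i.-1)) *: @bas R 'I_N (- i)).

Section I_and_A.
Variables l l' : weight.

Definition Imap_at_fun (f v : V) : VV := (Fmap l l')^-1%VF (tens f v).

Fact Imap_at_fun_linear (f : V) : linear (Imap_at_fun f).
Proof.
move=> a u v; rewrite /Imap_at_fun -linearP; congr (_ _); apply/ffunP => k.
by rewrite !ffunE mulrDr scalerAr.
Qed.
HB.instance Definition _ (f : V) := GRing.isLinear.Build C V VV *:%R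
  (Imap_at_fun f) (Imap_at_fun_linear f).

Definition Imap_fun (f : V) : 'Hom(V, VV) := linfun (Imap_at_fun f).

Fact Imap_fun_linear : linear Imap_fun.
Proof.
move=> a f g; apply/lfunP => v; rewrite !lfunE /= !lfunE /= !lfunE /=.
rewrite /Imap_at_fun -linearP; congr (_ _); apply/ffunP => k.
by rewrite !ffunE mulrDl scalerAl.
Qed.
HB.instance Definition _ := GRing.isLinear.Build C V 'Hom(V, VV) *:%R
  Imap_fun Imap_fun_linear.

(* I^{ll'}_{l,l'}, here with values in all linear maps; for a regular pair its
   image is the space of homomorphisms V_{ll'} -> V_l (x) V_l'. *)
Definition Imap : 'Hom(V, 'Hom(V, VV)) := linfun Imap_fun.

Definition AHom_vec (f : 'Hom(V, VV)) : vec R ('I_N * 'I_N * 'I_N)%type :=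
  tensop (tensop (opD (wdual l)) \1%VF) (opC (wmul l l'))
    (\sum_j tens (f (@bas R 'I_N j)) (@bas R 'I_N j)).

(* The g with \sum_j e_j (x) g(e_j) = AHom_vec f. *)
Definition AHom_fun (f : 'Hom(V, VV)) : 'Hom(V, VV) :=
  on_basis (fun j => [ffun ab => AHom_vec f (j, ab.1, ab.2)] : VV).

Fact AHom_fun_linear : linear AHom_fun.
Proof.
have Avec a f g : AHom_vec (a *: f + g) = a *: AHom_vec f + AHom_vec g.
  rewrite /AHom_vec -linearP scaler_sumr -big_split /=; congr (_ _).
  apply: eq_bigr => j _; apply/ffunP => k.
  by rewrite !lfunE /= !lfunE /= !ffunE mulrDl scalerAl.
move=> a f g; apply/lfunP => v; rewrite !lfunE /= !lfunE /= !lfunE /=.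
rewrite /on_basis_fun scaler_sumr -big_split /=; apply: eq_bigr => j _.
by apply/ffunP => k; rewrite Avec !ffunE scalerDr !scalerA [v j * a]mulrC.
Qed.
HB.instance Definition _ := GRing.isLinear.Build C 'Hom(V, VV) 'Hom(V, VV) *:%R
  AHom_fun AHom_fun_linear.

Definition AHom : 'Hom('Hom(V, VV), 'Hom(V, VV)) := linfun AHom_fun.

End I_and_A.

(* (Imap _ _)^-1 is the inverse of Imap _ _ on its image.  The spaces of
   homomorphisms of representations are not used as types here because
   l'(ll')^* = l^* is not a definitional equality. *)
Definition Amap (l l' : weight) : 'End(V) :=
  ((Imap l' (wdual (wmul l l')))^-1 \o (AHom l l' \o Imap l l'))%VF.

End Maps.

(* Main.v *)
(* F intertwines V_l (x) V_l' with M (x) V_{ll'}, because on the eigenspaces of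
   B_1 A_2 B_2^{-1} the recursion of w(a, c | n) is the identity
   Phi (c - a B_1 A_2 B_2^{-1}) B_2 = B_2 Phi.  By Schur's lemma a homomorphism
   V_{ll'} -> V_l (x) V_l' is therefore I(f) for a unique f, and T is the change
   of basis between the two ways of composing such homomorphisms:
   (I(f) (x) id) I(g) is the sum of the (id (x) I(f')) I(g') over the terms of
   T(g (x) f).  The operators C and D carry the transposes of the actions of X
   and Y to those of the antipode and its inverse on the dual weights, so A^Hom
   preserves homomorphisms.  Writing both sides of the claim as homomorphisms
   V_{l1^*} -> V_{l2} (x) V_{l3} (x) V_{l0^*}, each is the same rotation of one of
   the two composites of the first pentagon; on the contracted index the factors
   of C_{l4} and D_{l4^*} cancel. *)
Require Import Defs.
From mathcomp Require Import all_boot all_order all_algebra.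
From mathcomp Require Import complex ring.
From mathcomp Require Import all_classical all_reals all_analysis.
Set Implicit Arguments.
Unset Strict Implicit.
Unset Printing Implicit Defensive.
Import Order.TTheory GRing.Theory Num.Theory.
Local Open Scope ring_scope.
Local Open Scope complex_scope.

(** * Tensor factors *)

(** [Phi] and [Tmap] are only described through [xget], [Amap] uses a generalized inverse, and
    regularity speaks of invertible actions; each description must first be shown to be met. The
    operator O = B_1 A_2 B_2^{-1} satisfies O^N = id for odd N, so a spectral sum is the witness for
    [Phi]. Moreover Delta Y = (rt y rt x' O + rt y') B_2. If y x' + y' = 0, then - rt y' / (rt y rt
    x') is an N-th root of unity, hence an eigenvalue of O, and Y is not injective; this turns
    regularity into non-singularity of products. For T, both bracketings of the F's carry X and Y of
    the triple tensor product to the same multiples of A_3 and B_3, so their quotient acts on the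
    first two factors only. For A, homomorphisms are handled through relations between their
    coefficients. The exponents m_{y,1/x} in C and D compensate the discrepancy between rt (y/x) and
    rt y / rt x, which enters the action of Y on the dual module. *)

Section Tensors.
Variable R : realType.
Local Notation C := R[i].
Local Notation vec := (vec R).
Implicit Types I J K : finType.

Lemma bas_eq I (i : I) : @bas R I i i = 1.
Proof. by rewrite ffunE eqxx. Qed.

Lemma vec_sum_bas I (v : vec I) : v = \sum_i v i *: bas R i.
Proof.
apply/ffunP => j; rewrite sum_ffunE (bigD1 j) //= big1 => [|i ne_ij].
  by rewrite !ffunE eqxx addr0 /GRing.scale /= mulr1.
by rewrite !ffunE eq_sym (negPf ne_ij) /GRing.scale /= mulr0.
Qed.

Lemma hom_coord I J (f : 'Hom(vec I, vec J)) v j :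
  f v j = \sum_i v i * f (bas R i) j.
Proof.
rewrite {1}[v]vec_sum_bas linear_sum sum_ffunE; apply: eq_bigr => i _.
by rewrite linearZ ffunE.
Qed.

Lemma on_basisE I (U : vectType C) (f : I -> U) v :
  on_basis f v = \sum_i v i *: f i.
Proof. by rewrite lfunE. Qed.

Lemma on_basis_bas I (U : vectType C) (f : I -> U) i :
  on_basis f (bas R i) = f i.
Proof.
rewrite on_basisE (bigD1 i) //= big1 => [|j ne_ji]; first by rewrite bas_eq scale1r addr0.
by rewrite ffunE (negPf ne_ji) scale0r.
Qed.

Lemma hom_eq_bas I (U : vectType C) (f g : 'Hom(vec I, U)) :
  (forall i, f (bas R i) = g (bas R i)) -> f = g.
Proof.
move=> fg; apply/lfunP => v; rewrite [v]vec_sum_bas !linear_sum.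
by apply: eq_bigr => i _; rewrite !linearZ /= fg.
Qed.

Lemma tensE I J (u : vec I) (v : vec J) i j : tens u v (i, j) = u i * v j.
Proof. by rewrite ffunE. Qed.

Lemma tens_bas I J (i : I) (j : J) : tens (bas R i) (bas R j) = bas R (i, j).
Proof.
by apply/ffunP => -[k l]; rewrite !ffunE /= -natrM mulnb xpair_eqE.
Qed.

Section Legs.
Variables (K I : finType) (get : K -> I) (put : I -> K -> K).
Implicit Types O P : 'End(vec I).

Lemma legE O v k : leg get put O v k = O [ffun a => v (put a k)] (get k).
Proof. by rewrite lfunE /= ffunE. Qed.

Lemma leg_sum O v k :
  leg get put O v k = \sum_a v (put a k) * O (bas R a) (get k).
Proof. by rewrite legE hom_coord; apply: eq_bigr => a _; rewrite ffunE. Qed.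

Lemma legZ c O : leg get put (c *: O) = c *: leg get put O.
Proof.
by apply/lfunP => v; apply/ffunP => k; rewrite legE !scale_lfunE !ffunE legE.
Qed.

(** The lens laws, which hold whenever [get] and [put] access some of the slots of a tuple. *)
Hypothesis getK : forall a k, get (put a k) = a.
Hypothesis putK : forall k, put (get k) k = k.
Hypothesis put_put : forall a b k, put b (put a k) = put b k.

Lemma leg1 : leg get put (\1%VF : 'End(vec I)) = \1%VF.
Proof.
by apply/lfunP => v; apply/ffunP => k; rewrite legE !lfunE /= ffunE putK.
Qed.

Lemma leg_comp O P : leg get put (O \o P)%VF = (leg get put O \o leg get put P)%VF.
Proof.
apply/lfunP => v; apply/ffunP => k; rewrite comp_lfunE !legE comp_lfunE.
congr (O _ _); apply/ffunP => a; rewrite [RHS]ffunE legE getK.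
by congr (P _ a); apply/ffunP => b; rewrite !ffunE put_put.
Qed.

End Legs.

(** The hypotheses express that the two legs touch disjoint factors; both sides are then the same
    double sum. *)
Lemma leg_comm K I J (get : K -> I) put (get' : K -> J) put' O P v :
    (forall a k, get' (put a k) = get' k) ->
    (forall b k, get (put' b k) = get k) ->
    (forall a b k, put' b (put a k) = put a (put' b k)) ->
  leg get put O (leg get' put' P v) = leg get' put' P (leg get put O v) :> vec K.
Proof.
move=> g'p gp' pp'; apply/ffunP => k; rewrite !leg_sum.
under eq_bigr do rewrite leg_sum mulr_suml.
under [RHS]eq_bigr do rewrite leg_sum mulr_suml.
rewrite exchange_big; apply: eq_bigr => b _; apply: eq_bigr => a _.
by rewrite g'p gp' pp' mulrAC.
Qed.

(** [O^-1] is a generalized inverse, defined for every [O], so a genuine two-sided inverse has to be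
    identified with it. *)
Lemma end_bijP I (O P : 'End(vec I)) :
  (P \o O)%VF = \1%VF -> (O \o P)%VF = \1%VF -> O^-1%VF = P /\ bijective O.
Proof.
move=> PO OP; have OK : cancel O P by move=> v; rewrite -comp_lfunE PO lfunE.
have kerO : lker O == 0%VS by apply/lker0P; apply: can_inj OK.
split; last by exists P => // v; rewrite -comp_lfunE OP lfunE.
by rewrite -[LHS]comp_lfun1l -PO -comp_lfunA lker0_compfV ?comp_lfun1r.
Qed.

Lemma end_inj_bij I (O : 'End(vec I)) : injective O -> bijective O.
Proof.
move=> /lker0P kerO.
by exists (O^-1)%VF; [apply: lker0_lfunK | apply: lker0_lfunVK].
Qed.

Lemma end_bij_ker I (O : 'End(vec I)) : bijective O -> lker O == 0%VS.
Proof. by move=> /bij_inj injO; apply/lker0P. Qed.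

Lemma bij_lfunK I (O : 'End(vec I)) : bijective O -> cancel O (O^-1)%VF.
Proof. by move=> /end_bij_ker; apply: lker0_lfunK. Qed.

Lemma bij_lfunVK I (O : 'End(vec I)) : bijective O -> cancel (O^-1)%VF O.
Proof. by move=> /end_bij_ker; apply: lker0_lfunVK. Qed.

Lemma leg_inv K I (get : K -> I) put (O : 'End(vec I)) :
    (forall a k, get (put a k) = a) -> (forall k, put (get k) k = k) ->
    (forall a b k, put b (put a k) = put b k) ->
  bijective O ->
  leg get put O^-1%VF = (leg get put O)^-1%VF /\ bijective (leg get put O).
Proof.
move=> gp pg pp /end_bij_ker kO.
have [] := @end_bijP _ (leg get put O) (leg get put O^-1%VF).
- by rewrite -leg_comp // lker0_compVf // leg1.
- by rewrite -leg_comp // lker0_compfV // leg1.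
by move=> -> bijO; split.
Qed.

Lemma leg_bij K I (get : K -> I) put (O : 'End(vec I)) :
    (forall a k, get (put a k) = a) -> (forall k, put (get k) k = k) ->
    (forall a b k, put b (put a k) = put b k) ->
  bijective O -> bijective (leg get put O).
Proof. by move=> gp pg pp /(leg_inv gp pg pp)[]. Qed.

Lemma bij_scale I c (O : 'End(vec I)) : c != 0 -> bijective O -> bijective (c *: O).
Proof.
move=> c0 [P OK PK]; exists (fun v => P (c^-1 *: v)) => v.
  by rewrite scale_lfunE scalerA mulVf // scale1r OK.
by rewrite scale_lfunE PK scalerA mulfV // scale1r.
Qed.

Lemma at1E I J (O : 'End(vec I)) (v : vec (I * J)%type) i j :
  at1 O v (i, j) = O [ffun a => v (a, j)] i.
Proof. by rewrite legE. Qed.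

Lemma at2E I J (O : 'End(vec J)) (v : vec (I * J)%type) i j :
  at2 O v (i, j) = O [ffun b => v (i, b)] j.
Proof. by rewrite legE. Qed.

Lemma at21E I (O : 'End(vec (I * I)%type)) v i j :
  at21 O v (i, j) = O [ffun ab => v (ab.2, ab.1)] (j, i).
Proof. by rewrite legE. Qed.

Lemma at13E I (O : 'End(vec (I * I)%type)) v i j k :
  at13_3 O v (i, j, k) = O [ffun ab => v (ab.1, j, ab.2)] (i, k).
Proof. by rewrite legE. Qed.

Lemma at23E I (O : 'End(vec (I * I)%type)) v i j k :
  at23_3 O v (i, j, k) = O [ffun ab => v (i, ab.1, ab.2)] (j, k).
Proof. by rewrite legE. Qed.

Lemma at1_at2 I J (O : 'End(vec I)) (P : 'End(vec J)) v :
  at1 O (at2 P v) = at2 P (at1 O v).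
Proof. exact: leg_comm. Qed.

Lemma at1_comp I J (O P : 'End(vec I)) v :
  at1 (O \o P)%VF v = at1 O (at1 P v) :> vec (I * J)%type.
Proof. by rewrite -comp_lfunE -leg_comp. Qed.

Lemma at2_comp I J (O P : 'End(vec J)) v :
  at2 (O \o P)%VF v = at2 O (at2 P v) :> vec (I * J)%type.
Proof. by rewrite -comp_lfunE -leg_comp. Qed.

Lemma at1_tens I J (O : 'End(vec I)) u (v : vec J) :
  at1 O (tens u v) = tens (O u) v.
Proof.
apply/ffunP => -[i j]; rewrite at1E tensE (hom_coord O).
rewrite (hom_coord O u) mulr_suml; apply: eq_bigr => a _.
by rewrite !ffunE /= mulrAC.
Qed.

Lemma at2_tens I J (O : 'End(vec J)) (u : vec I) v :
  at2 O (tens u v) = tens u (O v).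
Proof.
apply/ffunP => -[i j]; rewrite at2E tensE (hom_coord O).
rewrite (hom_coord O v) mulr_sumr; apply: eq_bigr => a _.
by rewrite !ffunE /= mulrA.
Qed.

Lemma swapE I (v : vec (I * I)%type) i j : swap R I v (i, j) = v (j, i).
Proof.
rewrite on_basisE sum_ffunE (bigD1 (j, i)) //= big1 => [|[a b] ne].
  by rewrite !ffunE eqxx addr0 /GRing.scale /= mulr1.
rewrite !ffunE /=; case: eqP => [[ib ja]|_]; last by rewrite /GRing.scale /= mulr0.
by rewrite ib ja eqxx in ne.
Qed.

Lemma end_at1 K J (O : 'End(vec (K * J)%type)) (f : K -> vec K) :
  (forall k v, O (tens (bas R k) v) = tens (f k) v) -> O = at1 (on_basis f).
Proof.
move=> Of; apply: hom_eq_bas => -[k j].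
by rewrite -tens_bas Of at1_tens on_basis_bas.
Qed.

End Tensors.

(** * The root of unity and the operators A, B, C, D *)

Section RootOfUnity.
Variables (R : realType) (p : nat).
Local Notation C := R[i].
Local Notation N := p.+1.
Local Notation q := (q R p).
Local Notation e1 := (inZp 1 : 'I_N).

Lemma q_exp n : q ^+ n = cos (pi / N%:R *+ n) +i* sin (pi / N%:R *+ n).
Proof.
rewrite /Defs.q; elim: n => [|n IHn]; first by rewrite expr0 !mulr0n cos0 sin0.
rewrite exprSr IHn; set t := pi / _; rewrite mulrSr cosD sinD.
by apply/eqP; rewrite eq_complex /= eqxx addrC eqxx.
Qed.

Lemma q_expN : q ^+ N = -1.
Proof.
rewrite q_exp -mulr_natr divfK ?pnatr_eq0 // cospi sinpi.
by apply/eqP; rewrite eq_complex /= oppr0 !eqxx.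
Qed.

Lemma q_neq0 : q != 0.
Proof. by apply: contra_eq_neq q_expN => ->; rewrite expr0n /= eq_sym oppr_eq0 oner_eq0. Qed.

Lemma q2_prim : N.-primitive_root (q ^+ 2).
Proof.
apply/andP; split=> //; apply/forallP => i; rewrite unity_rootE -exprM.
have [->|neq_i] := eqVneq i.+1 N.
  by rewrite mulnC exprM q_expN sqrrN expr1n eqxx.
(* With x = pi (i+1) / N in the open interval from 0 to pi, the power is cos 2x + i sin 2x; its real
   part 1 - 2 sin^2 x differs from 1 because sin x > 0. *)
apply/eqP/negbTE; rewrite mulnC q_exp mulrnA -[pi / _ *+ _]mulr_natr mulrAC.
have lt_iN : (i.+1 < N)%N by rewrite ltn_neqAle neq_i ltn_ord.
set x := pi * _ / _; have x_bounds : 0 < x < pi.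
  rewrite divr_gt0 ?mulr_gt0 ?pi_gt0 ?ltr0n //=.
  by rewrite ltr_pdivrMr ?ltr0n // ltr_pM2l ?pi_gt0 // ltr_nat.
rewrite eq_complex /= cos_mulr2n cos2sin2; apply/nandP; left.
have -> : (1 - sin x ^+ 2) *+ 2 - 1 = 1 - sin x ^+ 2 *+ 2 by ring.
rewrite -subr_eq0 addrAC subrr add0r oppr_eq0 mulrn_eq0 /= sqrf_eq0.
by rewrite gt_eqF // sin_gt0_pi.
Qed.

(** A generator of the characters of Z/N, bijective onto the N-th roots of unity. Through it the
    exponents of q^2 can be added in ['I_N]. *)
Definition chi (i : 'I_N) : C := q ^+ (2 * i).

Lemma chiE i : chi i = q ^+ (2 * i).
Proof. by []. Qed.

Lemma chi_nat n : chi (inZp n) = q ^+ (2 * n).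
Proof. by rewrite /chi !exprM /= (prim_expr_mod q2_prim). Qed.

Lemma chiD i j : chi (i + j) = chi i * chi j.
Proof.
have -> : i + j = inZp (i + j)%N by apply: val_inj.
by rewrite chi_nat mulnDr exprD.
Qed.

Lemma chi0 : chi 0 = 1.
Proof. by rewrite /chi muln0. Qed.

Lemma chi_neq0 i : chi i != 0.
Proof. by rewrite expf_neq0 ?q_neq0. Qed.

Lemma chiN i : chi (- i) = (chi i)^-1.
Proof. by apply: (mulIf (chi_neq0 i)); rewrite -chiD addNr chi0 mulVf ?chi_neq0. Qed.

Lemma chi_expN i : chi i ^+ N = 1.
Proof. by rewrite /chi exprM exprAC (prim_expr_order q2_prim) expr1n. Qed.

Lemma chi_inj : injective chi.
Proof.
move=> i j /eqP; rewrite /chi !exprM (eq_prim_root_expr q2_prim).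
by rewrite !modn_small // => /eqP/val_inj.
Qed.

Lemma chi_surj (x : C) : x ^+ N = 1 -> exists i, x = chi i.
Proof. by case/(prim_rootP q2_prim) => i ->; exists i; rewrite /chi exprM. Qed.

Lemma val_ordS (i : 'I_N) : i + e1 = (i.+1 %% N)%N :> nat.
Proof. by rewrite /= modnDmr addn1. Qed.

Lemma ord_ind (P : 'I_N -> Prop) :
  P 0 -> (forall i, P i -> P (i + e1)) -> forall i, P i.
Proof.
move=> P0 PS [i lt_iN]; elim: i lt_iN => [|i IHi] lt_iN.
  by have -> : Ordinal lt_iN = 0 by apply: val_inj.
have -> : Ordinal lt_iN = Ordinal (ltnW lt_iN) + e1.
  by apply: ord_inj; rewrite val_ordS modn_small.
exact: PS.
Qed.

Lemma expr_ordS (x : C) (i : 'I_N) : x ^+ N = 1 -> x ^+ (i + e1)%R = x * x ^+ i.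
Proof. by move=> xN; rewrite val_ordS expr_mod // exprS. Qed.

Hypothesis oddN : odd N.

Lemma q_quad_ordS (i : 'I_N) :
  q ^+ ((i + e1)%R * (i + e1)%R.-1) = chi i * q ^+ (i * i.-1).
Proof.
rewrite val_ordS /chi -exprD.
have [lt_iN|] := ltnP i.+1 N.
  by rewrite modn_small //=; congr (_ ^+ _); case: {lt_iN}(val i) => // n; ring.
(* At the wrap from N-1 to 0 the exponents on the right add up to N (N-1), and q^N = -1 with N-1
   even gives 1. *)
move=> le_Ni; have iN : i.+1 = N by apply/eqP; rewrite eqn_leq ltn_ord le_Ni.
rewrite iN modnn expr0; have -> : (2 * i + i * i.-1 = i.+1 * i)%N.
  by case: (nat_of_ord i) => // n; ring.
rewrite iN exprM q_expN -signr_odd; have /= := oddN.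
by case: iN => ->; case: odd.
Qed.

Variable rt : C -> C.
Hypothesis hrt : root_choice p rt.

Lemma rt_exp z : z != 0 -> rt z ^+ N = z. Proof. by case: hrt => + _ _ _; exact. Qed.
Lemma rtV z : z != 0 -> rt z^-1 = (rt z)^-1.
Proof. by case: hrt => _ _ + _ => /[apply]. Qed.
Lemma rtN z : z != 0 -> rt (- z) = - rt z.
Proof. by case: hrt => _ _ _; exact. Qed.
Lemma rt_neq0 z : z != 0 -> rt z != 0.
Proof. by move=> z0; have := z0; rewrite -{1}(rt_exp z0) expf_eq0. Qed.

(** The quotient of the two roots has N-th power 1 and is thus a value of [chi], so the [pick] in
    [mroot] never reaches its default. *)
Lemma mrootP z w : z != 0 -> w != 0 ->
  rt (z * w) = chi (mroot p rt z w) * rt z * rt w.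
Proof.
move=> z0 w0; rewrite /mroot; case: pickP => [m /eqP //|no_m].
have zw0 : z * w != 0 by rewrite mulf_neq0.
have [|m Dm] := @chi_surj (rt (z * w) / (rt z * rt w)).
  by rewrite expr_div_n exprMn !rt_exp // divff.
move: (no_m m); rewrite -/(chi m) -Dm -mulrA divfK ?eqxx //.
by rewrite mulf_neq0 ?rt_neq0.
Qed.

(** Multiplying y by x^{-1} and then by x gives y back, and roots respect signs and inverses, so the
    two corrections cancel. *)
Lemma mroot_dual x y : x != 0 -> y != 0 ->
  chi (mroot p rt y x^-1) * chi (mroot p rt (- (y * x^-1)) x) = 1.
Proof.
move=> x0 y0; have yx0 : y * x^-1 != 0 by rewrite mulf_neq0 ?invr_eq0.
have := @mrootP (- (y * x^-1)) x; rewrite oppr_eq0 => /(_ yx0 x0).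
rewrite mulNr divfK // !rtN // mrootP ?invr_eq0 // rtV // => eq_y.
apply: (mulfI (rt_neq0 y0)); apply: oppr_inj; rewrite mulr1 [in RHS]eq_y.
by field; apply: rt_neq0.
Qed.

Local Notation V := (vec R 'I_N).
Implicit Types (v : V) (i : 'I_N).

Lemma opAE v i : opA R p v i = chi i * v i.
Proof.
rewrite on_basisE sum_ffunE (bigD1 i) //= big1 => [|j ne_ji].
  by rewrite !ffunE eqxx addr0 /GRing.scale /= mulr1 mulrC.
by rewrite !ffunE eq_sym (negPf ne_ji) /GRing.scale /= !mulr0.
Qed.

Lemma opBE v i : opB R p v i = v (i - e1).
Proof.
rewrite on_basisE sum_ffunE (bigD1 (i - e1)) //= big1 => [|j ne_ji].
  by rewrite !ffunE subrK eqxx addr0 /GRing.scale /= mulr1.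
by rewrite !ffunE -subr_eq eq_sym (negPf ne_ji) /GRing.scale /= !mulr0.
Qed.

Lemma opB_bas i : opB R p (bas R i) = bas R (i + e1).
Proof. exact: on_basis_bas. Qed.

Lemma opA_bas i : opA R p (bas R i) = chi i *: bas R i.
Proof. exact: on_basis_bas. Qed.

Definition shiftN : 'End(V) := on_basis (fun i => bas R (i - e1)).

Lemma opB_inv : (opB R p)^-1%VF = shiftN /\ bijective (opB R p).
Proof.
have shiftN_bas j : shiftN (bas R j) = bas R (j - e1) by exact: on_basis_bas.
apply: end_bijP; apply: hom_eq_bas => i; rewrite [RHS]id_lfunE [LHS]comp_lfunE.
  by rewrite [X in shiftN X]opB_bas [LHS]shiftN_bas addrK.
by rewrite [X in opB _ _ X]shiftN_bas [LHS]opB_bas subrK.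
Qed.

Lemma opBVE v i : (opB R p)^-1%VF v i = v (i + e1).
Proof.
rewrite (proj1 opB_inv) on_basisE sum_ffunE (bigD1 (i + e1)) //= big1 => [|j ne_ji].
  by rewrite !ffunE addrK eqxx addr0 /GRing.scale /= mulr1.
by rewrite !ffunE eq_sym subr_eq (negPf ne_ji) /GRing.scale /= !mulr0.
Qed.

Lemma opA_bij : bijective (opA R p).
Proof.
apply: end_inj_bij => u v uv; apply/ffunP => i.
have := congr1 (fun w : V => w i) uv; rewrite /= !opAE.
by move/(mulfI (chi_neq0 i)).
Qed.

Lemma opSE (v : vec R ('I_N * 'I_N)%type) i j : opS R p v (i, j) = v (i, j - i).
Proof.
rewrite on_basisE sum_ffunE (bigD1 (i, j - i)) //= big1 => [|[a b] ne].
  by rewrite !ffunE /= [i + _]addrC subrK eqxx addr0 /GRing.scale /= mulr1.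
rewrite !ffunE /=; case: eqP => [[ia jb]|_]; last by rewrite /GRing.scale /= mulr0.
by rewrite ia jb addrC addKr eqxx in ne.
Qed.

Lemma opS_bij : bijective (opS R p).
Proof.
apply: end_inj_bij => u v uv; apply/ffunP => -[i j].
have := congr1 (fun w : vec _ _ => w (i, j + i)) uv.
by rewrite /= !opSE addrK.
Qed.

Definition gam (l : weight R) (i : 'I_N) : C :=
  q ^- (2 * i * mroot p rt l.2 l.1^-1) * q ^- (i * i.-1).
Definition del (l : weight R) (i : 'I_N) : C :=
  q ^- (2 * i * mroot p rt l.2 l.1^-1) * q ^+ (i * i.-1).

Lemma on_basis_oppE (f : 'I_N -> C) v i :
  on_basis (fun j => f j *: bas R (- j)) v i = f (- i) * v (- i).
Proof.
rewrite on_basisE sum_ffunE (bigD1 (- i)) //= big1 => [|j ne_ji].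
  by rewrite !ffunE opprK eqxx addr0 /GRing.scale /= mulr1 mulrC.
by rewrite !ffunE -eqr_oppLR eq_sym (negPf ne_ji) /GRing.scale /= !mulr0.
Qed.

Lemma opCE l v i : opC p rt l v i = gam l (- i) * v (- i).
Proof. exact: on_basis_oppE. Qed.

Lemma opDE l v i : opD p rt l v i = del l (- i) * v (- i).
Proof. exact: on_basis_oppE. Qed.

Lemma chi_mulnC (i m : 'I_N) : q ^+ (2 * i * m) = chi m ^+ i.
Proof. by rewrite /chi -exprM mulnAC. Qed.

(** The linear exponent contributes a constant ratio, the quadratic one a factor [chi i]. The
    relation for Y only compares neighbouring coefficients, so such ratios are all that
    [hom_coefs_rotate] needs. *)
Lemma gamS l i :
  gam l (i + e1) = (chi (mroot p rt l.2 l.1^-1))^-1 * (chi i)^-1 * gam l i.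
Proof.
rewrite /gam !chi_mulnC expr_ordS ?chi_expN // q_quad_ordS !invfM; ring.
Qed.

Lemma delS l i :
  del l (i + e1) = (chi (mroot p rt l.2 l.1^-1))^-1 * chi i * del l i.
Proof.
rewrite /del !chi_mulnC expr_ordS ?chi_expN // q_quad_ordS !invfM; ring.
Qed.

(** The quadratic exponents of C and D are opposite, and the linear ones cancel by [mroot_dual]. *)
Lemma gam_del l i : l.1 != 0 -> l.2 != 0 -> gam l i * del (wdual l) i = 1.
Proof.
case: l => x y /= x0 y0; rewrite /gam /del /= invrK !chi_mulnC.
have := mroot_dual x0 y0; set a := chi _; set b := chi _ => ab.
rewrite mulrACA mulVf ?mulr1 ?expf_neq0 ?q_neq0 //.
by rewrite -invfM -exprMn ab expr1n invr1.
Qed.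

End RootOfUnity.

(** * Spectral calculus and the cyclic dilogarithm *)

Lemma sum_ordS_periodic (V : nmodType) (f : nat -> V) n :
  f n = f 0 -> \sum_(k < n) f k.+1 = \sum_(k < n) f k.
Proof.
case: n => [|n] fn0; first by rewrite !big_ord0.
by rewrite big_ord_recr big_ord_recl fn0 addrC.
Qed.

Section Spectral.
Variables (R : realType) (p : nat).
Local Notation C := R[i].
Local Notation N := p.+1.
Local Notation e1 := (inZp 1 : 'I_N).
Local Notation chi := (@chi R p).
Local Notation vec := (vec R).

Lemma chiMn (i : 'I_N) k : chi (i *+ k) = chi i ^+ k.
Proof. by elim: k => [|k IHk]; rewrite ?mulr0n ?chi0 // mulrS chiD IHk exprS. Qed.

Lemma chi_sym (i j : 'I_N) : chi i ^+ j = chi j ^+ i.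
Proof. by rewrite -!chi_mulnC mulnAC. Qed.

Lemma chi1 : chi e1 = q R p ^+ 2.
Proof. by rewrite chi_nat. Qed.

Lemma chi1_exp (i : 'I_N) : chi e1 ^+ i = chi i.
Proof. by rewrite chi1 chiE exprM. Qed.

Lemma e1_mulrn_ord : e1 *+ N = 0.
Proof. by apply: (@chi_inj R p); rewrite chiMn chi_expN chi0. Qed.

Lemma sum_chi_exp (i : 'I_N) : \sum_(k < N) chi i ^+ k = (if i == 0 then N%:R else 0).
Proof.
have [->|i0] := eqVneq i 0.
  by rewrite chi0; under eq_bigr do rewrite expr1n; rewrite sumr_const card_ord.
have : (chi i - 1) * (\sum_(k < N) chi i ^+ k) = 0 by rewrite -subrX1 chi_expN subrr.
move/eqP; rewrite mulf_eq0 subr_eq0 => /orP[|/eqP//].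
by rewrite -(chi0 R p) => /eqP/chi_inj i_0; rewrite i_0 eqxx in i0.
Qed.

Variables (V : vectType C) (O : 'End(V)).

(** The same iteration as [lfun_exp], over an arbitrary [vectType], so that the spectral arguments
    see no coordinates. *)
Definition lfun_pow k : 'End(V) := iter k (comp_lfun O) \1%VF.

Lemma lfun_powS k v : lfun_pow k.+1 v = O (lfun_pow k v).
Proof. exact: comp_lfunE. Qed.

Lemma lfun_pow0 v : lfun_pow 0 v = v.
Proof. exact: id_lfunE. Qed.

Hypothesis O_N : forall v, lfun_pow N v = v.

(** Averaging over the cyclic group generated by O: the projection onto the [chi i]-eigenspace. *)
Definition eproj (i : 'I_N) : 'End(V) :=
  N%:R^-1 *: \sum_(k < N) chi i ^- k *: lfun_pow k.

Lemma eprojE i v : eproj i v = N%:R^-1 *: \sum_(k < N) chi i ^- k *: lfun_pow k v.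
Proof.
rewrite scale_lfunE sum_lfunE; congr (_ *: _).
by apply: eq_bigr => k _; rewrite scale_lfunE.
Qed.

Lemma eproj_eigen i v : O (eproj i v) = chi i *: eproj i v.
Proof.
rewrite eprojE linearZ scalerA mulrC -scalerA /=; congr (_ *: _).
rewrite linear_sum scaler_sumr /=.
transitivity (\sum_(k < N) (chi i *: (chi i ^- k.+1 *: lfun_pow k.+1 v))).
  apply: eq_bigr => k _; rewrite linearZ lfun_powS scalerA /=.
  by rewrite exprS invfM mulrA mulfV ?mul1r // chi_neq0.
rewrite (@sum_ordS_periodic _ (fun k => chi i *: (chi i ^- k *: lfun_pow k v))) //.
by rewrite chi_expN expr0 O_N lfun_pow0.
Qed.

Lemma eproj_sum v : \sum_i eproj i v = v.
Proof.
under eq_bigr do rewrite eprojE; rewrite -scaler_sumr exchange_big /=.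
under eq_bigr do rewrite -scaler_suml.
(* By [chi_sym] a sum over all characters at k is a sum over the powers of the single value
   [chi (- k)]. *)
have chi_sum (k : 'I_N) : \sum_(i < N) chi i ^- k = (if k == 0 then N%:R else 0).
  rewrite -oppr_eq0 -sum_chi_exp; apply: eq_bigr => i _.
  by rewrite chiN exprVn chi_sym.
rewrite big_ord_recl chi_sum eqxx big1 => [|k _].
  by rewrite addr0 lfun_pow0 scalerA mulVf ?scale1r // pnatr_eq0.
by rewrite chi_sum scale0r.
Qed.

(** O is diagonalizable because O^N = id. Identities that involve [Phi] are reduced by this to
    eigenvectors, where [Phi] is a scalar. *)
Lemma eigen_ext (U : vectType C) (f g : 'Hom(V, U)) :
  (forall i v, O v = chi i *: v -> f v = g v) -> f = g.
Proof.
move=> fg; apply/lfunP => v; rewrite -(eproj_sum v) !linear_sum.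
by apply: eq_bigr => i _; apply: fg (eproj_eigen i v).
Qed.

Lemma eproj_on_eigen i j v : O v = chi i *: v -> eproj j v = (if i == j then v else 0).
Proof.
move=> Ov; have Ok k : lfun_pow k v = chi i ^+ k *: v.
  elim: k => [|k IHk]; first by rewrite lfun_pow0 scale1r.
  by rewrite lfun_powS IHk linearZ /= Ov scalerA exprSr.
rewrite eprojE; under eq_bigr do rewrite Ok scalerA -exprVn -exprMn.
rewrite -scaler_suml mulrC -chiN -chiD sum_chi_exp subr_eq0 scalerA.
case: eqP => _; last by rewrite mulr0 scale0r.
by rewrite mulVf ?scale1r // pnatr_eq0.
Qed.

Definition spec (s : 'I_N -> C) : 'End(V) := \sum_i s i *: eproj i.

Lemma spec_eigen s i v : O v = chi i *: v -> spec s v = s i *: v.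
Proof.
move=> Ov; rewrite sum_lfunE (bigD1 i) //= big1 => [|j ne_ji].
  by rewrite scale_lfunE (eproj_on_eigen _ Ov) eqxx addr0.
by rewrite scale_lfunE (eproj_on_eigen _ Ov) eq_sym (negPf ne_ji) scaler0.
Qed.

Lemma spec_inv s : (forall i, s i != 0) ->
  (spec s \o spec (fun i => (s i)^-1)%R = \1)%VF.
Proof.
move=> s0; apply: eigen_ext => i v Ov; rewrite comp_lfunE (spec_eigen _ Ov) linearZ /=.
by rewrite (spec_eigen _ Ov) scalerA mulVf // scale1r id_lfunE.
Qed.

End Spectral.

Section PhiSpec.
Variables (R : realType) (p : nat) (I : finType) (O : 'End(vec R I)).
Local Notation C := R[i].
Hypothesis O_N : forall v, lfun_exp O p.+1 v = v.

Lemma spec_bij (s : 'I_p.+1 -> C) : (forall i, s i != 0) -> bijective (spec O s).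
Proof.
move=> s0; have [] // := @end_bijP _ _ (spec O s) (spec O (fun i => (s i)^-1)).
  rewrite -[RHS](spec_inv O_N (s := fun i => (s i)^-1)) => [|i]; last by rewrite invr_eq0.
  by congr (_ \o spec O _)%VF; apply: funext => i; rewrite invrK.
exact: spec_inv.
Qed.

(** The spectral sum meets the description under [xget], and the values on eigenvectors leave no
    other choice. *)
Lemma Phi_spec zeta a c :
  Phi p zeta a c O = spec O (fun i : 'I_p.+1 => zeta a c * wfun p a c i).
Proof.
apply: (eigen_ext O_N) => i v Ov; rewrite (spec_eigen _ Ov).
rewrite /Phi; set P := (X in xget 0 X).
suff: P (xget 0 P) by apply.
by apply: xgetPex; exists (spec O (fun i : 'I_p.+1 => zeta a c * wfun p a c i)) => j u /spec_eigen.
Qed.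

Lemma Phi_eigen zeta a c (i : 'I_p.+1) v : O v = chi R i *: v ->
  Phi p zeta a c O v = (zeta a c * wfun p a c i) *: v.
Proof. by move=> Ov; rewrite Phi_spec (spec_eigen _ Ov). Qed.

Lemma Phi_bij zeta a c :
  (forall i : 'I_p.+1, zeta a c * wfun p a c i != 0) -> bijective (Phi p zeta a c O).
Proof. by move=> s0; rewrite Phi_spec; apply: spec_bij. Qed.

End PhiSpec.

Section Weights.
Variables (R : realType) (p : nat).
Local Notation C := R[i].
Local Notation N := p.+1.
Local Notation e1 := (inZp 1 : 'I_N).
Local Notation chi := (@chi R p).
Variables a c : C.
Hypotheses (a0 : a != 0) (acN : c ^+ N - a ^+ N = 1).

(** The factorization of X^N - 1 at c / a, multiplied by a^N, gives c^N - a^N. Its factor of index 0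
    appears here with index N, as q^{2N} = 1. *)
Lemma wfun_prod : \prod_(1 <= j < N.+1) (c - a * q R p ^+ (2 * j)) = 1.
Proof.
have := congr1 (fun P => P.[c / a]) (factor_Xn_sub_1 (q2_prim R p)).
rewrite [LHS]horner_prod [RHS]hornerD hornerN hornerXn hornerC.
under eq_bigr do rewrite hornerXsubC.
rewrite big_ltn // expr0 => eq_prod.
rewrite big_nat_recr //= exprM (prim_expr_order (q2_prim R p)) mulr1.
under eq_big_nat do rewrite exprM.
have -> : \prod_(1 <= i < N) (c - a * (q R p ^+ 2) ^+ i) =
    a ^+ p * \prod_(1 <= i < N) (c / a - (q R p ^+ 2) ^+ i).
  have <- : \prod_(1 <= i < N) a = a ^+ p by rewrite prodr_const_nat subn1.
  rewrite -big_split /=.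
  by apply: eq_bigr => i _; field.
have -> : c - a = a * (c / a - 1) by field.
by rewrite mulrACA -exprSr [_ * (c / a - 1)]mulrC eq_prod mulrBr mulr1 expr_div_n mulrC divfK // expf_neq0.
Qed.

Lemma wfun_factor_neq0 i : c - a * chi i != 0.
Proof.
have nz0 (k : nat) : (0 < k <= N)%N -> c - a * q R p ^+ (2 * k) != 0.
  move=> k_bounds; have := oner_neq0 C; rewrite -wfun_prod.
  apply: contra_neq => ck0; apply/eqP; rewrite prodf_seq_eq0; apply/hasP.
  by exists k; [rewrite mem_index_iota ltnS | rewrite /= ck0 eqxx].
(* The product runs over 1, ..., N, so the residue 0 is represented by the factor of index N. *)
have [i0|i_gt0] := posnP i; last by apply: nz0; rewrite i_gt0 ltnW.
have := nz0 N; rewrite leqnn => /(_ isT).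
by rewrite exprM (prim_expr_order (q2_prim R p)) chiE i0 muln0.
Qed.

Lemma wfun_neq0 (i : 'I_N) : wfun p a c i != 0.
Proof.
rewrite /wfun prodf_seq_neq0; apply/allP => k _ /=.
by rewrite invr_eq0 -chi_nat wfun_factor_neq0.
Qed.

Lemma wfunS (i : 'I_N) :
  wfun p a c (i + e1)%R * (c - a * chi (i + e1)) = wfun p a c i.
Proof.
have step k : wfun p a c k.+1 * (c - a * chi (inZp k.+1)) = wfun p a c k.
  by rewrite /wfun big_nat_recr //= chi_nat mulfVK // -chi_nat wfun_factor_neq0.
have -> : chi (i + e1) = chi (inZp i.+1) by rewrite !chi_nat chiD chi1 chiE mulnS exprD mulrC.
(* At the wrap from N-1 to 0 the recursion needs w at N to equal w at 0, which is [wfun_prod]. *)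
rewrite -[RHS]step val_ordS; have [lt_iN|le_Ni] := ltnP i.+1 N; first by rewrite modn_small.
have -> : i.+1 = N by apply/eqP; rewrite eqn_leq ltn_ord le_Ni.
rewrite modnn; congr (_ * _); rewrite /wfun big_nil prodfV wfun_prod invr1 //.
Qed.

End Weights.

(** * The isomorphism F *)

Section PairOperators.
Variables (R : realType) (p : nat).
Local Notation C := R[i].
Local Notation N := p.+1.
Local Notation e1 := (inZp 1 : 'I_N).
Local Notation chi := (@chi R p).
Local Notation VV := (vec R ('I_N * 'I_N)%type).
Hypothesis oddN : odd N.

Variables A1 A2 B1 B2 O : 'End(VV).
Hypothesis A1E : forall v i j, A1 v (i, j) = chi i * v (i, j).
Hypothesis A2E : forall v i j, A2 v (i, j) = chi j * v (i, j).
Hypothesis B1E : forall v i j, B1 v (i, j) = v (i - e1, j).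
Hypothesis B2E : forall v i j, B2 v (i, j) = v (i, j - e1).
Hypothesis OE : forall v i j, O v (i, j) = chi j * v (i - e1, j + e1).

(** Each further application multiplies by [chi] at an index already shifted k times, whence the
    binomial coefficient. For odd N it is divisible by N when k = N, and O^N = id follows. *)
Lemma O_exp k v i j : lfun_exp O k v (i, j) =
  chi j ^+ k * chi e1 ^+ 'C(k, 2) * v (i - e1 *+ k, j + e1 *+ k).
Proof.
elim: k i j => [|k IHk] i j.
  by rewrite id_lfunE bin0n !expr0 !mul1r !mulr0n subr0 addr0.
rewrite [lfun_exp _ _ _]comp_lfunE OE IHk binS bin1 exprD exprS chiD exprMn.
by rewrite !mulrS opprD !addrA !mulrA [_ * chi e1 ^+ k]mulrAC.
Qed.

Lemma O_N v : lfun_exp O N v = v.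
Proof.
apply/ffunP => -[i j]; rewrite O_exp !(e1_mulrn_ord R) subr0 addr0 chi_expN.
by rewrite bin2odd // exprM chi_expN expr1n !mul1r.
Qed.

(** This factors B_2 out of both terms of Delta Y and leaves a linear polynomial in O. *)
Lemma O_B2 v : O (B2 v) = B1 (A2 v).
Proof. by apply/ffunP => -[i j]; rewrite OE B2E addrK B1E A2E. Qed.

Lemma O_B2_comm v : O (B2 v) = chi e1 *: B2 (O v).
Proof.
rewrite O_B2; apply/ffunP => -[i j].
rewrite B1E A2E ffunE B2E OE subrK.
by rewrite /GRing.scale /= mulrA -chiD [e1 + _]addrC subrK.
Qed.

(** O lowers one index and raises the other, and A_1 A_2 depends only on their sum. *)
Lemma O_AA_comm v : O (A1 (A2 v)) = A1 (A2 (O v)).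
Proof.
apply/ffunP => -[i j].
rewrite OE !A1E !A2E OE !mulrA -!chiD.
by congr (chi _ * _); rewrite addrACA subrK addrC addrA.
Qed.

End PairOperators.

Section QuantumPair.
Variables (R : realType) (p : nat).
Local Notation C := R[i].
Local Notation N := p.+1.
Local Notation e1 := (inZp 1 : 'I_N).
Local Notation chi := (@chi R p).
Hypothesis oddN : odd N.

Variable W : vectType C.
Variables A1 A2 B1 B2 O : 'End(W).

Let lfunZ (f : 'End(W)) k v : f (k *: v) = k *: f v. Proof. exact: linearZ. Qed.

Hypothesis O_N : forall v, lfun_pow O N v = v.
Hypothesis O_B2 : forall v, O (B2 v) = B1 (A2 v).
Hypothesis O_B2_comm : forall v, O (B2 v) = chi e1 *: B2 (O v).
Hypothesis O_AA_comm : forall v, O (A1 (A2 v)) = A1 (A2 (O v)).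
Hypothesis B2_bij : bijective B2.
Variable w0 : W.
Hypothesis w0_neq0 : w0 != 0.

Lemma O_eigen_B2 i v : O v = chi i *: v -> O (B2 v) = chi (i + e1) *: B2 v.
Proof. by move=> Ov; rewrite O_B2_comm Ov linearZ scalerA chiD mulrC. Qed.

(** The projections of [w0] sum to [w0], so some eigenspace is non-zero; the injective B_2 raises
    the index of the eigenvalue by one and carries an eigenvector to every other eigenspace. *)
Lemma O_eigenvector i : exists2 v, v != 0 & O v = chi i *: v.
Proof.
suff [j [v v0 Ov]] : exists j, exists2 v, v != 0 & O v = chi j *: v.
  rewrite -(subrK j i); elim/ord_ind: (i - j) => [|k [u u0 Ou]].
    by exists v; rewrite ?add0r.
  exists (B2 u); last by rewrite addrAC; apply: O_eigen_B2.
  by apply: contra_neq u0 => Bu0; apply: (bij_inj B2_bij); rewrite linear0.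
have [j vj0] : exists j : 'I_N, eproj O j w0 != 0.
  apply/existsP; apply: contraNT w0_neq0; rewrite negb_exists => /forallP all0.
  rewrite -[w0](eproj_sum p O) big1 // => j _.
  by apply/eqP; rewrite -[_ == 0]negbK all0.
by exists j, (eproj O j w0); last exact: (eproj_eigen O_N).
Qed.

Variable rt : C -> C.
Hypothesis hrt : root_choice p rt.
Variable zeta : C -> C -> C.
Hypothesis hzeta : forall a c : C, c ^+ N - a ^+ N = 1 -> zeta a c != 0.
Variables x y x' y' : C.
Hypotheses (x0 : x != 0) (y0 : y != 0) (x'0 : x' != 0) (y'0 : y' != 0).

(* If y x' + y' = 0 then Delta Y = (rt y rt x' O + rt y') B_2 kills a vector. *)
Lemma coproduct_Y_inj :
  injective (fun v : W => (rt y * rt x') *: B1 (A2 v) + rt y' *: B2 v) ->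
  y * x' + y' != 0.
Proof.
move=> injY; apply/eqP => yx0.
have rts0 : rt y * rt x' != 0 by rewrite mulf_neq0 ?(rt_neq0 hrt).
have [|i Di] := @chi_surj R p (- (rt y' / (rt y * rt x'))).
  rewrite exprNn -signr_odd oddN expr1 mulN1r expr_div_n exprMn !(rt_exp hrt) //.
  have -> : y' = - (y * x') by apply/eqP; rewrite -addr_eq0 addrC yx0.
  by rewrite mulNr opprK divff // mulf_neq0.
have [u u0 Ou] := O_eigenvector i.
have [B2i _ B2K] := B2_bij; pose v := B2i u; have Dv : u = B2 v by rewrite /v B2K.
have : v = 0.
  apply: injY; rewrite /= !linear0 ?scaler0 addr0 -O_B2 -Dv Ou -Di.
  rewrite scalerA -scalerDl.
  by rewrite mulrN mulrC divfK // addNr scale0r.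
by move=> v_0; rewrite Dv v_0 linear0 eqxx in u0.
Qed.

Hypothesis d0 : y * x' + y' != 0.

Let d := rt (y * x' + y').
Let a := - (rt y * rt x' / d).
Let c := rt y' / d.

Let dn0 : d != 0. Proof. exact: rt_neq0 hrt _ d0. Qed.

Let a_neq0 : a != 0.
Proof. by rewrite oppr_eq0 !mulf_neq0 ?invr_eq0 // (rt_neq0 hrt). Qed.

Let acN : c ^+ N - a ^+ N = 1.
Proof.
(* For odd N the term -a^N is y x' / (y x' + y'), and c^N is y' / (y x' + y'). *)
rewrite /a exprNn -signr_odd oddN expr1 mulN1r opprK !exprMn exprVn.
by rewrite !(rt_exp hrt) // -mulrDl addrC divff.
Qed.

Lemma pair_spectrum_neq0 (i : 'I_N) : zeta a c * wfun p a c i != 0.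
Proof. by rewrite mulf_neq0 ?hzeta ?wfun_neq0. Qed.

Variable Ph : 'End(W).
Hypothesis Ph_eigen : forall (i : 'I_N) v,
  O v = chi i *: v -> Ph v = (zeta a c * wfun p a c i) *: v.

Lemma Phi_AA v : Ph (A1 (A2 v)) = A1 (A2 (Ph v)).
Proof.
have -> : Ph (A1 (A2 v)) = (Ph \o (A1 \o A2))%VF v by rewrite !comp_lfunE.
have -> : A1 (A2 (Ph v)) = (A1 \o A2 \o Ph)%VF v by rewrite !comp_lfunE.
apply: (congr1 (fun L : 'End(W) => L v)); apply: (eigen_ext O_N) => i u Ou.
rewrite !comp_lfunE (Ph_eigen Ou) !linearZ /=; apply: Ph_eigen.
by rewrite O_AA_comm Ou !linearZ.
Qed.

Lemma Phi_Y v :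
  Ph ((rt y * rt x') *: B1 (A2 v) + rt y' *: B2 v) = d *: B2 (Ph v).
Proof.
pose f := (Ph \o ((rt y * rt x') *: (B1 \o A2) + rt y' *: B2))%VF.
transitivity (f v).
  by rewrite comp_lfunE add_lfunE !scale_lfunE comp_lfunE.
transitivity ((d *: (B2 \o Ph))%VF v); last by rewrite scale_lfunE comp_lfunE.
apply: (congr1 (fun L : 'End(W) => L v)); apply: (eigen_ext O_N) => i u Ou.
rewrite comp_lfunE add_lfunE !scale_lfunE !comp_lfunE -O_B2.
have Bu := O_eigen_B2 Ou; rewrite Bu scalerA -scalerDl !lfunZ.
rewrite (Ph_eigen Bu) (Ph_eigen Ou) lfunZ !scalerA; congr (_ *: _).
(* B_2 moves u to the eigenvalue of index i + 1, where rt y rt x' O + rt y' is d (c - a O); the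
   recursion of [wfun] absorbs the second factor and leaves d. *)
rewrite -(wfunS a_neq0 acN i) /a /c; field.
exact: dn0.
Qed.

Variables S Bm : 'End(W).
Hypothesis S_AA : forall v, S (A1 (A2 v)) = A2 (S v).
Hypothesis S_B : forall v, S (B2 v) = B2 (S v).
Hypothesis Bm_A : forall v, Bm (A2 v) = chi (mroot p rt x x') *: A2 (Bm v).
Hypothesis Bm_B : forall v, Bm (B2 v) = B2 (Bm v).

Variable F : 'End(W).
Hypothesis FE : forall v, F v = Bm (S (Ph v)).

(** This is the purpose of the power of B_2 in F: passing A_2, it yields the factor by which rt (x
    x') differs from rt x rt x'. *)
Lemma F_X v : F ((rt x * rt x') *: A1 (A2 v)) = rt (x * x') *: A2 (F v).
Proof.
rewrite !FE lfunZ Phi_AA lfunZ S_AA lfunZ Bm_A.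
by rewrite scalerA (mrootP hrt) //; congr (_ *: _); ring.
Qed.

Lemma F_Y v :
  F ((rt y * rt x') *: B1 (A2 v) + rt y' *: B2 v) = d *: B2 (F v).
Proof. by rewrite !FE Phi_Y lfunZ S_B lfunZ Bm_B. Qed.

End QuantumPair.

(** * Several tensor factors *)

Section MoreLegs.
Variable R : realType.
Local Notation C := R[i].
Local Notation vec := (vec R).
Variables (K I : finType) (get : K -> I) (put : I -> K -> K).
Hypothesis getK : forall a k, get (put a k) = a.
Hypothesis put_put : forall a b k, put b (put a k) = put b k.
Implicit Types F O P : 'End(vec I).

Lemma legD O P : leg get put (O + P) = leg get put O + leg get put P.
Proof.
by apply/lfunP => v; apply/ffunP => k; rewrite legE !add_lfunE !ffunE !legE.
Qed.

Lemma leg_intertwine F O P : (forall v, F (O v) = P (F v)) ->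
  forall v, leg get put F (leg get put O v) = leg get put P (leg get put F v).
Proof.
move=> FOP v; rewrite -!comp_lfunE -!leg_comp //; congr (leg _ _ _ v).
by apply/lfunP => u; rewrite !comp_lfunE.
Qed.

Lemma leg_injective (k0 : K) O : injective (leg get put O) -> injective O.
Proof.
move=> injO u v Ouv.
(* The extension is constant along the other factors, so the leg acts on it as [O] does; [k0]
   provides a point at which the result is read off. *)
pose ext (w : vec I) : vec K := [ffun k => w (get k)].
have legO w k : leg get put O (ext w) k = O w (get k).
  by rewrite legE; congr (O _ _); apply/ffunP => a; rewrite !ffunE getK.
have /ffunP eq_ext : ext u = ext v by apply: injO; apply/ffunP => k; rewrite !legO Ouv.
by apply/ffunP => a; have := eq_ext (put a k0); rewrite !ffunE getK.
Qed.

End MoreLegs.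

Section ThreeLegs.
Variables (R : realType) (I : finType).
Local Notation vec := (vec R).
Implicit Types (O : 'End(vec I)) (v : vec (I * I * I)%type).

Lemma tensopE (J L : finType) (f : 'End(vec J)) (g : 'End(vec L)) (v : vec (J * L)%type) :
  tensop f g v = at1 f (at2 g v).
Proof. by rewrite [LHS]comp_lfunE. Qed.

Lemma at23_at1 O v : at23_3 (at1 O) v = at1 (at2 O) v.
Proof.
apply/ffunP => -[[i j] k]; rewrite [LHS]at23E [LHS]at1E [RHS]at1E [RHS]at2E.
by congr (O _ _); apply/ffunP => a; rewrite !ffunE.
Qed.

Lemma at23_at2 O v : at23_3 (at2 O) v = at2 O v.
Proof.
apply/ffunP => -[[i j] k]; rewrite [LHS]at23E [LHS]at2E [RHS]at2E.
by congr (O _ _); apply/ffunP => a; rewrite !ffunE.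
Qed.

Lemma at13_at1 O v : at13_3 (at1 O) v = at1 (at1 O) v.
Proof.
apply/ffunP => -[[i j] k]; rewrite [LHS]at13E [LHS]at1E [RHS]at1E [RHS]at1E.
by congr (O _ _); apply/ffunP => a; rewrite !ffunE.
Qed.

Lemma at13_at2 O v : at13_3 (at2 O) v = at2 O v.
Proof.
apply/ffunP => -[[i j] k]; rewrite [LHS]at13E [LHS]at2E [RHS]at2E.
by congr (O _ _); apply/ffunP => a; rewrite !ffunE.
Qed.

Lemma at23_3_comp (F G : 'End(vec (I * I)%type)) v :
  at23_3 (F \o G)%VF v = at23_3 F (at23_3 G v).
Proof. by rewrite -comp_lfunE -leg_comp // => -[]. Qed.

Lemma at11_leg O : at1 (at1 O) = leg (fun k => k.1.1) (fun a k => (a, k.1.2, k.2)) O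
  :> 'End(vec (I * I * I)%type).
Proof.
apply/lfunP => v; apply/ffunP => -[[i j] k]; rewrite [LHS]at1E [LHS]at1E [RHS]legE.
by congr (O _ _); apply/ffunP => a; rewrite !ffunE.
Qed.

Lemma at23_at11 (F : 'End(vec (I * I)%type)) O v :
  at23_3 F (at1 (at1 O) v) = at1 (at1 O) (at23_3 F v).
Proof. by rewrite at11_leg; apply: leg_comm. Qed.

End ThreeLegs.

Section Scaling.
Variables (R : realType) (I J : finType).

Lemma at1Z c (O : 'End(vec R I)) v :
  at1 (c *: O) v = c *: at1 O v :> vec R (I * J)%type.
Proof. by rewrite [at1 _]legZ scale_lfunE. Qed.

Lemma at2Z c (O : 'End(vec R J)) v :
  at2 (c *: O) v = c *: at2 O v :> vec R (I * J)%type.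
Proof. by rewrite [at2 _]legZ scale_lfunE. Qed.

Lemma at1D (O P : 'End(vec R I)) v :
  at1 (O + P) v = at1 O v + at1 P v :> vec R (I * J)%type.
Proof. by rewrite [at1 _]legD add_lfunE. Qed.

End Scaling.

Section Bijections.
Variables (R : realType) (I J : finType).
Local Notation vec := (vec R).

Lemma comp_bij (f g : 'End(vec I)) :
  bijective f -> bijective g -> bijective (f \o g)%VF.
Proof.
move=> [f' fK Kf] [g' gK Kg]; exists (g' \o f')%FUN => v /=.
  by rewrite [X in f' X]comp_lfunE fK gK.
by rewrite [LHS]comp_lfunE Kg Kf.
Qed.

Lemma at1_bij (O : 'End(vec I)) :
  bijective O -> bijective (at1 O : 'End(vec (I * J)%type)).
Proof. by apply: leg_bij => // -[]. Qed.

Lemma at2_bij (O : 'End(vec J)) :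
  bijective O -> bijective (at2 O : 'End(vec (I * J)%type)).
Proof. by apply: leg_bij => // -[]. Qed.

Lemma lfun_exp_bij (f : 'End(vec I)) k : bijective f -> bijective (lfun_exp f k).
Proof.
move=> bf; elim: k => [|k IHk]; last exact: comp_bij.
by exists id => v; rewrite [\1%VF _]id_lfunE.
Qed.

Lemma inv_lfun_bij (f : 'End(vec I)) : bijective f -> bijective (f^-1)%VF.
Proof. by exists f; [apply: bij_lfunVK | apply: bij_lfunK]. Qed.

End Bijections.

Section FmapPair.
Variables (R : realType) (p : nat).
Local Notation C := R[i].
Local Notation N := p.+1.
Local Notation e1 := (inZp 1 : 'I_N).
Local Notation chi := (@chi R p).
Local Notation A := (opA R p).
Local Notation B := (opB R p).
Local Notation VV := (vec R ('I_N * 'I_N)%type).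
Hypothesis oddN : odd N.

Let A1E (v : VV) i j : at1 A v (i, j) = chi i * v (i, j).
Proof. by rewrite [LHS]at1E [LHS]opAE ffunE. Qed.
Let A2E (v : VV) i j : at2 A v (i, j) = chi j * v (i, j).
Proof. by rewrite [LHS]at2E [LHS]opAE ffunE. Qed.
Let B1E (v : VV) i j : at1 B v (i, j) = v (i - e1, j).
Proof. by rewrite [LHS]at1E [LHS]opBE ffunE. Qed.
Let B2E (v : VV) i j : at2 B v (i, j) = v (i, j - e1).
Proof. by rewrite [LHS]at2E [LHS]opBE ffunE. Qed.
Let Bi2E (v : VV) i j : at2 B^-1%VF v (i, j) = v (i, j + e1).
Proof. by rewrite [LHS]at2E [LHS]opBVE ffunE. Qed.

Let O : 'End(VV) := (at1 B \o (at2 A \o at2 B^-1))%VF.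

Let OE (v : VV) i j : O v (i, j) = chi j * v (i - e1, j + e1).
Proof.
rewrite (_ : O v = at1 B (at2 A (at2 B^-1%VF v))); last first.
  by rewrite [LHS]comp_lfunE; congr (at1 B _); rewrite [LHS]comp_lfunE.
by rewrite [LHS]B1E [LHS]A2E Bi2E.
Qed.

Lemma opBV_exp_A k v :
  lfun_exp B^-1 k (A v) = chi e1 ^+ k *: A (lfun_exp B^-1 k v).
Proof.
have expE u i : lfun_exp B^-1 k u i = u (i + e1 *+ k).
  elim: k i => [|k IHk] i; first by rewrite [lfun_exp _ _ _]id_lfunE mulr0n addr0.
  by rewrite [lfun_exp _ _ _]comp_lfunE [LHS]opBVE [LHS]IHk mulrS addrA.
apply/ffunP => i; rewrite [RHS]ffunE [LHS]expE !opAE expE chiD chiMn /GRing.scale /=.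
by rewrite [chi i * _]mulrC mulrA.
Qed.

Lemma opBV_exp_B k v : lfun_exp B^-1 k (B v) = B (lfun_exp B^-1 k v).
Proof.
elim: k => [|k IHk]; first by rewrite ![lfun_exp _ 0 _]id_lfunE.
rewrite ![lfun_exp _ k.+1 _]comp_lfunE IHk; have [_ bB] := opB_inv R p.
by rewrite bij_lfunK // bij_lfunVK.
Qed.

Let S_AA (v : VV) : opS R p (at1 A (at2 A v)) = at2 A (opS R p v).
Proof.
apply/ffunP => -[i j]; rewrite [LHS]opSE [LHS]A1E A2E [RHS]A2E opSE mulrA -chiD.
by rewrite [i + _]addrC subrK.
Qed.

Let S_B (v : VV) : opS R p (at2 B v) = at2 B (opS R p v).
Proof.
by apply/ffunP => -[i j]; rewrite [LHS]opSE [LHS]B2E [RHS]B2E opSE addrAC.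
Qed.

Variable rt : C -> C.
Hypothesis hrt : root_choice p rt.
Variable zeta : C -> C -> C.
Hypothesis hzeta : forall a c : C, c ^+ N - a ^+ N = 1 -> zeta a c != 0.
Variables l l' : weight R.
Hypotheses (nl : nonsingular l) (nl' : nonsingular l').

(** The action of Y on the tensor product of [repV l] and [repV l'], with the scalars collected. *)
Definition copY : 'End(VV) :=
  (rt l.2 * rt l'.1) *: (at1 B \o at2 A)%VF + rt l'.2 *: at2 B.

Lemma copYE v :
  copY v = (rt l.2 * rt l'.1) *: at1 B (at2 A v) + rt l'.2 *: at2 B v.
Proof.
rewrite [LHS]add_lfunE; congr (_ + _); last by rewrite [LHS]scale_lfunE.
by rewrite [LHS]scale_lfunE; congr (_ *: _); rewrite [LHS]comp_lfunE.
Qed.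

Let Oexp := O_N oddN OE.
Let OB2 := O_B2 A2E B1E B2E OE.
Let OB2c := O_B2_comm A2E B1E B2E OE.

Lemma copY_inj : injective copY -> nonsingular (wmul l l').
Proof.
move=> injY; case/andP: nl => x0 y0; case/andP: nl' => x'0 y'0.
apply/andP; split; first by rewrite mulf_neq0.
have bas0 : bas R (0 : 'I_N, 0 : 'I_N) != 0.
  apply/eqP => /(congr1 (fun w : VV => w (0, 0))).
  by rewrite /= bas_eq ffunE; apply/eqP/oner_neq0.
apply: (coproduct_Y_inj oddN Oexp OB2 OB2c _ bas0 hrt y0 x'0 y'0).
  exact: at2_bij (proj2 (opB_inv R p)).
by move=> u v uv; apply: injY; rewrite [LHS]copYE [RHS]copYE.
Qed.

Hypothesis nll' : nonsingular (wmul l l').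

Let F := Fmap p rt zeta l l'.
Let d := rt (l.2 * l'.1 + l'.2).
Let a := - (rt l.2 * rt l'.1 / d).
Let c := rt l'.2 / d.
Let Ph := Phi p zeta a c O.
Let Bm : 'End(VV) := at2 (lfun_exp B^-1 (mroot p rt l.1 l'.1)).

Let F_def : F = (Bm \o (opS R p \o Ph))%VF.
Proof. by rewrite /F /Bm /Ph /a /c /d; case: l => x y; case: l'. Qed.

Let FE v : F v = Bm (opS R p (Ph v)).
Proof. by rewrite F_def [LHS]comp_lfunE; congr (Bm _); rewrite [LHS]comp_lfunE. Qed.

Let Ph_eigen := @Phi_eigen R p _ O Oexp zeta a c.

Lemma Fmap_bij : bijective F.
Proof.
case/andP: nl => x0 y0; case/andP: nl' => x'0 y'0; case/andP: nll' => _ d0.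
rewrite F_def; apply: comp_bij; last apply: comp_bij (opS_bij R p) _.
  exact/at2_bij/lfun_exp_bij/inv_lfun_bij/(proj2 (opB_inv R p)).
by apply: (Phi_bij Oexp) => i; apply: (pair_spectrum_neq0 oddN hrt hzeta).
Qed.

Lemma Fmap_X v : F ((rt l.1 * rt l'.1) *: at1 A (at2 A v)) =
  rt (wmul l l').1 *: at2 A (F v).
Proof.
case/andP: nl => x0 y0; case/andP: nl' => x'0 y'0.
apply: (F_X Oexp (O_AA_comm A1E A2E OE) hrt x0 x'0 Ph_eigen S_AA _ FE v) => u.
rewrite -!at2_comp -at2Z; congr (at2 _ u); apply/lfunP => w.
by rewrite [RHS]scale_lfunE !comp_lfunE opBV_exp_A chi1_exp.
Qed.

Lemma Fmap_Y v : F ((rt l.2 * rt l'.1) *: at1 B (at2 A v) + rt l'.2 *: at2 B v) =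
  rt (wmul l l').2 *: at2 B (F v).
Proof.
case/andP: nl => x0 y0; case/andP: nl' => x'0 y'0; case/andP: nll' => _ d0.
apply: (F_Y oddN Oexp OB2 OB2c hrt y0 x'0 y'0 d0 Ph_eigen S_B _ FE v) => u.
rewrite -!at2_comp; congr (at2 _ u); apply/lfunP => w.
by rewrite !comp_lfunE opBV_exp_B.
Qed.

(** F conjugates this action to a non-zero multiple of A_2. *)
Lemma pair_X_injective :
  injective (fun v : VV => (rt l.1 * rt l'.1) *: at1 A (at2 A v)).
Proof.
have bA : bijective (at2 A : 'End(VV)) by apply: at2_bij (opA_bij R p).
move=> u v uv; apply: (bij_inj Fmap_bij); apply: (bij_inj bA).
have c0 : rt (wmul l l').1 != 0 by apply: (rt_neq0 hrt); case/andP: nll'.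
by apply: (can_inj (scalerK c0)); rewrite -[LHS]Fmap_X uv [LHS]Fmap_X.
Qed.

Lemma pair_Y_injective : injective
  (fun v : VV => (rt l.2 * rt l'.1) *: at1 B (at2 A v) + rt l'.2 *: at2 B v).
Proof.
have bB : bijective (at2 B : 'End(VV)) by apply: at2_bij (proj2 (opB_inv R p)).
move=> u v uv; apply: (bij_inj Fmap_bij); apply: (bij_inj bB).
have c0 : rt (wmul l l').2 != 0 by apply: (rt_neq0 hrt); case/andP: nll'.
by apply: (can_inj (scalerK c0)); rewrite -[LHS]Fmap_Y uv [LHS]Fmap_Y.
Qed.

End FmapPair.

Section TripleAbstract.
Variables (F : fieldType) (W : vectType F).
Variables A1 A2 A3 B1 B2 B3 F12 F43 F23 F15 : 'End(W).
Variables x1 x2 x3 x4 x5 x0 y1 y2 y3 y4 y5 y0 : F.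

Let lfunZ (f : 'End(W)) k v : f (k *: v) = k *: f v. Proof. exact: linearZ. Qed.
Let lfunD (f : 'End(W)) u v : f (u + v) = f u + f v. Proof. exact: linearD. Qed.

Let X v := (x1 * x2 * x3) *: A1 (A2 (A3 v)).
Let Y v := (y1 * x2 * x3) *: B1 (A2 (A3 v)) + (y2 * x3) *: B2 (A3 v) + y3 *: B3 v.

Section Left.
Hypothesis F12X : forall v, F12 ((x1 * x2) *: A1 (A2 v)) = x4 *: A2 (F12 v).
Hypothesis F12Y : forall v,
  F12 ((y1 * x2) *: B1 (A2 v) + y2 *: B2 v) = y4 *: B2 (F12 v).
Hypothesis F12A3 : forall v, F12 (A3 v) = A3 (F12 v).
Hypothesis F12B3 : forall v, F12 (B3 v) = B3 (F12 v).
Hypothesis F43X : forall v, F43 ((x4 * x3) *: A2 (A3 v)) = x0 *: A3 (F43 v).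
Hypothesis F43Y : forall v,
  F43 ((y4 * x3) *: B2 (A3 v) + y3 *: B3 v) = y0 *: B3 (F43 v).

(** The first two terms of Y are the coproduct action on factors 1 and 2 followed by A_3, and F_12
    merges these factors into one. As F_43 does not enter, the identity also serves where the triple
    product is not yet known to be non-singular. *)
Lemma F12_triple_Y v :
  F12 (Y v) = (y4 * x3) *: B2 (A3 (F12 v)) + y3 *: B3 (F12 v).
Proof.
have -> : Y v = x3 *: ((y1 * x2) *: B1 (A2 (A3 v)) + y2 *: B2 (A3 v)) + y3 *: B3 v.
  by rewrite /Y scalerDr !scalerA ![x3 * _]mulrC.
by rewrite lfunD !lfunZ F12Y F12B3 F12A3 scalerA mulrC.
Qed.

Lemma left_X v : F43 (F12 (X v)) = x0 *: A3 (F43 (F12 v)).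
Proof.
rewrite /X [x1 * x2 * x3]mulrC -scalerA lfunZ F12X F12A3 scalerA [x3 * _]mulrC.
exact: F43X.
Qed.

Lemma left_Y v : F43 (F12 (Y v)) = y0 *: B3 (F43 (F12 v)).
Proof. by rewrite F12_triple_Y F43Y. Qed.
End Left.

Section Right.
Hypothesis F23X : forall v, F23 ((x2 * x3) *: A2 (A3 v)) = x5 *: A3 (F23 v).
Hypothesis F23Y : forall v,
  F23 ((y2 * x3) *: B2 (A3 v) + y3 *: B3 v) = y5 *: B3 (F23 v).
Hypothesis F23A1 : forall v, F23 (A1 v) = A1 (F23 v).
Hypothesis F23B1 : forall v, F23 (B1 v) = B1 (F23 v).
Hypothesis F15X : forall v, F15 ((x1 * x5) *: A1 (A3 v)) = x0 *: A3 (F15 v).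
Hypothesis F15Y : forall v,
  F15 ((y1 * x5) *: B1 (A3 v) + y5 *: B3 v) = y0 *: B3 (F15 v).

Lemma right_X v : F15 (F23 (X v)) = x0 *: A3 (F15 (F23 v)).
Proof.
have -> : X v = x1 *: A1 ((x2 * x3) *: A2 (A3 v)) by rewrite /X (lfunZ A1) scalerA mulrA.
by rewrite lfunZ F23A1 F23X (lfunZ A1) scalerA F15X.
Qed.

Lemma right_Y v : F15 (F23 (Y v)) = y0 *: B3 (F15 (F23 v)).
Proof.
have -> : Y v = y1 *: B1 ((x2 * x3) *: A2 (A3 v)) + ((y2 * x3) *: B2 (A3 v) + y3 *: B3 v).
  by rewrite /Y (lfunZ B1) scalerA mulrA addrA.
by rewrite lfunD lfunZ F23B1 F23X F23Y (lfunZ B1) scalerA F15Y.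
Qed.
End Right.

End TripleAbstract.

(** By surjectivity it suffices to compare the two sides at L u, where c times each of them is L' (X
    u). *)
Lemma intertwine_factor (F : fieldType) (W : vectType F) (O P : 'End(W)) (L L' X : W -> W)
    (c : F) :
  c != 0 -> (forall w, exists u, w = L u) ->
  (forall v, L (X v) = c *: P (L v)) -> (forall v, L' (X v) = c *: P (L' v)) ->
  (forall v, O (L v) = L' v) -> forall w, O (P w) = P (O w).
Proof.
move=> c0 Lsurj LX L'X OL w; have [u ->] := Lsurj w.
apply: (can_inj (scalerK c0)); rewrite OL -L'X -OL LX.
by rewrite linearZ.
Qed.

Lemma comp_lfun4E (F : fieldType) (W : vectType F) (f g h k : 'End(W)) v :
  (f \o (g \o (h \o k)))%VF v = f (g (h (k v))).
Proof. by rewrite !comp_lfunE. Qed.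

Section LegIntertwine.
Variables (R : realType) (K J : finType) (get : K -> J) (put : J -> K -> K).
Hypothesis getK : forall a k, get (put a k) = a.
Hypothesis put_put : forall a b k, put b (put a k) = put b k.
Local Notation lg := (leg get put).
Implicit Types F P Q S : 'End(vec R J).

Let legZE c P v : lg (c *: P) v = c *: lg P v.
Proof. by rewrite [lg _]legZ [LHS]scale_lfunE. Qed.

Let legZcE c P Q v : lg (c *: (P \o Q)%VF) v = c *: lg P (lg Q v).
Proof.
rewrite [LHS]legZE; congr (_ *: _).
by rewrite [lg _]leg_comp // [LHS]comp_lfunE.
Qed.

Lemma leg_intertwine_X F P Q S c d :
  (forall v, F (c *: P (Q v)) = d *: S (F v)) ->
  forall v, lg F (c *: lg P (lg Q v)) = d *: lg S (lg F v).
Proof.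
move=> FX v; have E u : F ((c *: (P \o Q))%VF u) = (d *: S) (F u).
  by rewrite [RHS]scale_lfunE -FX; congr (F _); rewrite [LHS]scale_lfunE comp_lfunE.
by rewrite -[RHS]legZE -(leg_intertwine getK put_put E v) [in RHS]legZcE.
Qed.

Lemma leg_intertwine_Y F P Q P' S c c' d :
  (forall v, F (c *: P (Q v) + c' *: P' v) = d *: S (F v)) ->
  forall v, lg F (c *: lg P (lg Q v) + c' *: lg P' v) = d *: lg S (lg F v).
Proof.
move=> FY v; have E u : F ((c *: (P \o Q) + c' *: P')%VF u) = (d *: S) (F u).
  rewrite [RHS]scale_lfunE -FY; congr (F _); rewrite [LHS]add_lfunE.
  congr (_ + _); last exact: scale_lfunE.
  by rewrite [LHS]scale_lfunE; congr (_ *: _); apply: comp_lfunE.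
rewrite -[RHS]legZE -(leg_intertwine getK put_put E v); congr (lg F _).
symmetry; rewrite [lg (_ + _)]legD [LHS]add_lfunE.
by congr (_ + _); [apply: legZcE | apply: legZE].
Qed.

End LegIntertwine.

Section ThreeLegs.
Variables (R : realType) (I : finType).
Variables (F : 'End(vec R (I * I)%type)) (A B B' S : 'End(vec R I)) (c c' d : R[i]).
Implicit Type v : vec R (I * I * I)%type.

Section X.
Hypothesis FX : forall u, F (c *: at1 A (at2 B u)) = d *: at2 S (F u).

Lemma at12_X v :
  at12_3 F (c *: at1 (at1 A) (at1 (at2 B) v)) = d *: at1 (at2 S) (at12_3 F v).
Proof. exact: leg_intertwine_X FX v. Qed.

Lemma at23_X v :
  at23_3 F (c *: at1 (at2 A) (at2 B v)) = d *: at2 S (at23_3 F v).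
Proof.
rewrite -at23_at1 -!at23_at2; apply: leg_intertwine_X FX v => //.
by case.
Qed.

Lemma at13_X v :
  at13_3 F (c *: at1 (at1 A) (at2 B v)) = d *: at2 S (at13_3 F v).
Proof.
rewrite -at13_at1 -!at13_at2; apply: leg_intertwine_X FX v => //.
by case.
Qed.
End X.

Section Y.
Hypothesis FY : forall u, F (c *: at1 A (at2 B u) + c' *: at2 B' u) = d *: at2 S (F u).

Lemma at12_Y v :
  at12_3 F (c *: at1 (at1 A) (at1 (at2 B) v) + c' *: at1 (at2 B') v) =
  d *: at1 (at2 S) (at12_3 F v).
Proof. exact: leg_intertwine_Y FY v. Qed.

Lemma at23_Y v :
  at23_3 F (c *: at1 (at2 A) (at2 B v) + c' *: at2 B' v) = d *: at2 S (at23_3 F v).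
Proof.
rewrite -at23_at1 -!at23_at2; apply: leg_intertwine_Y FY v => //.
by case.
Qed.

Lemma at13_Y v :
  at13_3 F (c *: at1 (at1 A) (at2 B v) + c' *: at2 B' v) = d *: at2 S (at13_3 F v).
Proof.
rewrite -at13_at1 -!at13_at2; apply: leg_intertwine_Y FY v => //.
by case.
Qed.
End Y.

Lemma at23_coproduct v :
  at23_3 (c *: (at1 A \o at2 B)%VF + c' *: at2 B') v =
  c *: at1 (at2 A) (at2 B v) + c' *: at2 B' v.
Proof.
rewrite [at23_3 _]legD [LHS]add_lfunE; apply: f_equal2.
  rewrite [leg _ _ _]legZ [LHS]scale_lfunE -at23_at2 -at23_at1.
  by rewrite -at23_3_comp.
by rewrite [leg _ _ _]legZ [LHS]scale_lfunE -at23_at2.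
Qed.

Lemma at12_at3 v : at12_3 F (at2 A v) = at2 A (at12_3 F v).
Proof. exact: at1_at2. Qed.

Lemma at12_3_bij : bijective F -> bijective (at12_3 F).
Proof. exact: at1_bij. Qed.

Lemma at23_3_bij : bijective F -> bijective (at23_3 F).
Proof. by apply: leg_bij => [[]//|[[]]|]. Qed.

Lemma at13_3_bij : bijective F -> bijective (at13_3 F).
Proof. by apply: leg_bij => [[]//|[[]]|]. Qed.

Lemma at12_3_inv : bijective F -> at12_3 F^-1%VF = (at12_3 F)^-1%VF.
Proof. by move=> bF; refine (proj1 (leg_inv _ _ _ bF)) => [||] // []. Qed.

Lemma at23_3_inv : bijective F -> at23_3 F^-1%VF = (at23_3 F)^-1%VF.
Proof. by move=> bF; refine (proj1 (leg_inv _ _ _ bF)) => [[]|[[]]|]. Qed.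

End ThreeLegs.

(** * Schur's lemma *)

Section Schur.
Variables (R : realType) (p : nat).
Local Notation N := p.+1.
Local Notation e1 := (inZp 1 : 'I_N).
Local Notation A := (opA R p).
Local Notation B := (opB R p).
Local Notation V := (vec R 'I_N).

(** The vector e_0 is fixed by A, so its image lies in the 1-eigenspace of A_2 and has the form f
    (x) e_0. Powers of B carry this to every other e_j with the same f. *)
Lemma commuting_hom_tens (K : finType) (h : 'Hom(V, vec R (K * 'I_N)%type)) :
  (forall v, h (A v) = at2 A (h v)) -> (forall v, h (B v) = at2 B (h v)) ->
  exists f : vec R K, forall v, h v = tens f v.
Proof.
move=> hA hB; pose f : vec R K := [ffun k => h (bas R 0) (k, 0)]; exists f.
have h_bas j k m : h (bas R j) (k, m) = (m == j)%:R * f k.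
  elim/ord_ind: j m => [|j IHj] m; last first.
    by rewrite -opB_bas hB [LHS]at2E [LHS]opBE ffunE IHj subr_eq.
  have [->|m0] := eqVneq m 0; first by rewrite mul1r ffunE.
  have := congr1 (fun w : vec R (K * 'I_N)%type => w (k, m)) (hA (bas R 0)).
  rewrite /= opA_bas chi0 scale1r at2E opAE ffunE mul0r => /eqP.
  rewrite -subr_eq0 -{1}[h _ _]mul1r -mulrBl mulf_eq0 subr_eq0 => /orP[|/eqP//].
  by rewrite -(chi0 R p) => /eqP/chi_inj m_0; rewrite -m_0 eqxx in m0.
move=> v; apply/ffunP => -[k m]; rewrite [LHS]hom_coord tensE.
rewrite (bigD1 m) //= big1 => [|j ne_jm].
  by rewrite h_bas eqxx mul1r addr0 mulrC.
by rewrite h_bas eq_sym (negPf ne_jm) mul0r mulr0.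
Qed.

(** For each basis vector k of the first factor, v maps to [O] (e_k (x) v) as in
    [commuting_hom_tens]; the resulting f's are the columns of [T]. *)
Lemma commuting_end_at1 (K : finType) (O : 'End(vec R (K * 'I_N)%type)) :
  (forall v, O (at2 A v) = at2 A (O v)) -> (forall v, O (at2 B v) = at2 B (O v)) ->
  exists T : 'End(vec R K), O = at1 T.
Proof.
move=> OA OB.
pose h k : 'Hom(V, vec R (K * 'I_N)%type) := on_basis (fun j => O (bas R (k, j))).
have hE k v : h k v = O (tens (bas R k) v).
  rewrite [LHS]on_basisE; transitivity (O (\sum_j v j *: bas R (k, j))).
    by rewrite linear_sum; apply: eq_bigr => j _; rewrite linearZ.
  congr (O _); apply/ffunP => -[k' j]; rewrite sum_ffunE tensE (bigD1 j) //= big1.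
    rewrite addr0 !ffunE xpair_eqE eqxx andbT /GRing.scale /=.
    by rewrite mulrC.
  by move=> i ne_ij; rewrite !ffunE xpair_eqE eq_sym [_ == i]eq_sym (negPf ne_ij) andbF /GRing.scale /= mulr0.
have /choice [f Hf] k : exists f : vec R K, forall v, h k v = tens f v.
  apply: commuting_hom_tens => v.
    by rewrite [LHS]hE -at2_tens OA [in RHS]hE.
  by rewrite [LHS]hE -at2_tens OB [in RHS]hE.
by exists (on_basis f); apply: end_at1 => k v; rewrite -hE Hf.
Qed.

End Schur.

Section TensorReps.
Variables (R : realType) (I : finType).
Variables (A B A' B' : 'End(vec R I)) (x y x' y' : R[i]).

Lemma tensop_X v :
  tensop (x *: A) (x' *: A') v = (x * x') *: at1 A (at2 A' v).
Proof. by rewrite [LHS]tensopE [LHS]at1Z at2Z linearZ scalerA. Qed.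

Lemma tensop_Y v :
  (tensop (y *: B) (x' *: A') + tensop \1%VF (y' *: B')) v =
  (y * x') *: at1 B (at2 A' v) + y' *: at2 B' v.
Proof.
rewrite [LHS]add_lfunE; congr (_ + _).
  by rewrite [LHS]tensopE [LHS]at1Z at2Z linearZ scalerA.
by rewrite [LHS]tensopE at2Z [at1 _]leg1 ?id_lfunE // => -[].
Qed.
End TensorReps.

Section TensorReps3.
Variables (R : realType) (I : finType).
Variables (A B A' B' A'' B'' : 'End(vec R I)) (x y x' y' x'' y'' : R[i]).

Lemma tensop3_X v :
  tensop (tensop (x *: A) (x' *: A')) (x'' *: A'') v =
  (x * x' * x'') *: at1 (at1 A) (at1 (at2 A') (at2 A'' v)).
Proof.
rewrite [LHS]tensopE at2Z linearZ /=.
have -> : tensop (x *: A) (x' *: A') = (x * x') *: (at1 A \o at2 A')%VF.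
  apply/lfunP => u; rewrite [LHS]tensop_X [RHS]scale_lfunE.
  by congr (_ *: _); rewrite [RHS]comp_lfunE.
rewrite at1Z scalerA mulrC; congr (_ *: _).
exact: at1_comp.
Qed.

Lemma tensop3_Y v :
  (tensop (tensop (y *: B) (x' *: A') + tensop \1%VF (y' *: B')) (x'' *: A'') +
   tensop \1%VF (y'' *: B'')) v =
  (y * x' * x'') *: at1 (at1 B) (at1 (at2 A') (at2 A'' v)) +
  (y' * x'') *: at1 (at2 B') (at2 A'' v) + y'' *: at2 B'' v.
Proof.
rewrite [LHS]add_lfunE; congr (_ + _); last first.
  by rewrite [LHS]tensopE at2Z [at1 _]leg1 ?id_lfunE // => -[].
rewrite [LHS]tensopE at2Z linearZ /=.
have -> : tensop (y *: B) (x' *: A') + tensop \1%VF (y' *: B') =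
    (y * x') *: (at1 B \o at2 A')%VF + y' *: at2 B'.
  apply/lfunP => u; rewrite [LHS]tensop_Y [RHS]add_lfunE; congr (_ + _).
    by rewrite [RHS]scale_lfunE; congr (_ *: _); rewrite [RHS]comp_lfunE.
  by rewrite [RHS]scale_lfunE.
rewrite at1D [LHS]scalerDr; apply: f_equal2.
  rewrite [X in _ *: X]at1Z scalerA mulrC; congr (_ *: _); exact: at1_comp.
by rewrite [X in _ *: X]at1Z scalerA mulrC.
Qed.

End TensorReps3.

(** * Regular triples and T *)

Lemma wmulA (R : realType) (l l' l'' : weight R) :
  wmul l (wmul l' l'') = wmul (wmul l l') l''.
Proof.
case: l l' l'' => x y [x' y'] [x'' y'']; rewrite /wmul /= mulrA.
by rewrite mulrDl !mulrA addrA.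
Qed.

Section Triple.
Variables (R : realType) (p : nat).
Local Notation C := R[i].
Local Notation N := p.+1.
Local Notation A := (opA R p).
Local Notation B := (opB R p).
Local Notation W := (vec R ('I_N * 'I_N * 'I_N)%type).
Hypothesis oddN : odd N.
Variable rt : C -> C.
Hypothesis hrt : root_choice p rt.
Variable zeta : C -> C -> C.
Hypothesis hzeta : forall a c : C, c ^+ N - a ^+ N = 1 -> zeta a c != 0.
Local Notation F := (Fmap p rt zeta).
Variables l1 l2 l3 : weight R.
Hypotheses (n1 : nonsingular l1) (n2 : nonsingular l2) (n3 : nonsingular l3).

Let A1 : 'End(W) := at1 (at1 A).
Let A2 : 'End(W) := at1 (at2 A).
Let A3 : 'End(W) := at2 A.
Let B1 : 'End(W) := at1 (at1 B).
Let B2 : 'End(W) := at1 (at2 B).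
Let B3 : 'End(W) := at2 B.

Let l4 := wmul l1 l2.
Let l5 := wmul l2 l3.
Let l0 := wmul l4 l3.

Let X v := (rt l1.1 * rt l2.1 * rt l3.1) *: A1 (A2 (A3 v)).
Let Y v := (rt l1.2 * rt l2.1 * rt l3.1) *: B1 (A2 (A3 v)) +
  (rt l2.2 * rt l3.1) *: B2 (A3 v) + rt l3.2 *: B3 v.

Section Left.
Hypothesis n4 : nonsingular l4.
Let F12 := at12_3 (F l1 l2).
Let F43 := at23_3 (F l4 l3).

Let F12X := at12_X (Fmap_X oddN hrt zeta n1 n2).
Let F12Y := at12_Y (Fmap_Y oddN hrt zeta n1 n2 n4).
Let F12A3 : forall v, F12 (A3 v) = A3 (F12 v) := at12_at3 (F l1 l2) A.
Let F12B3 : forall v, F12 (B3 v) = B3 (F12 v) := at12_at3 (F l1 l2) B.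

Let F12_bij : bijective F12 := at12_3_bij (Fmap_bij oddN hrt hzeta n1 n2 n4).

Let left_Y12 v : F12 (Y v) = (rt l4.2 * rt l3.1) *: B2 (A3 (F12 v)) + rt l3.2 *: B3 (F12 v).
Proof. exact: (F12_triple_Y _ _ F12Y F12A3 F12B3). Qed.

(** F_12 turns the action of Y on three factors into that for the pair [l4], [l3] on factors 2 and
    3, so injectivity passes to [copY] and the criterion for pairs applies. *)
Lemma triple_Y_inj : injective Y -> nonsingular l0.
Proof.
move=> injY; apply: (copY_inj oddN hrt n4 n3).
have [F' F'K FK'] := F12_bij.
have injG : injective (at23_3 (copY p rt l4 l3)).
  move=> u v Guv; rewrite -(FK' u) -(FK' v); congr (F12 _); apply: injY.
  apply: (can_inj F'K); rewrite [LHS]left_Y12 [RHS]left_Y12 !FK'.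
  by move: Guv; rewrite [LHS]at23_coproduct [RHS]at23_coproduct.
by apply: (leg_injective _ (0, 0, 0) injG) => -[].
Qed.

Hypothesis n0 : nonsingular l0.

Let F43X := at23_X (Fmap_X oddN hrt zeta n4 n3).
Let F43Y := at23_Y (Fmap_Y oddN hrt zeta n4 n3 n0).

Lemma triple_left_X v : F43 (F12 (X v)) = rt l0.1 *: A3 (F43 (F12 v)).
Proof. exact: (left_X F12X F12A3 F43X). Qed.

Lemma triple_left_Y v : F43 (F12 (Y v)) = rt l0.2 *: B3 (F43 (F12 v)).
Proof. exact: (left_Y F12Y F12A3 F12B3 F43Y). Qed.

Lemma triple_left_bij : bijective F12 /\ bijective F43.
Proof. by split=> //; exact: at23_3_bij (Fmap_bij oddN hrt hzeta n4 n3 n0). Qed.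

Lemma triple_X_injective : injective X.
Proof.
have [bF12 bF43] := triple_left_bij.
have bA : bijective A3 by apply: at2_bij (opA_bij R p).
move=> u v Xuv; apply: (bij_inj bF12); apply: (bij_inj bF43); apply: (bij_inj bA).
have c0 : rt l0.1 != 0 by apply: (rt_neq0 hrt); case/andP: n0.
by apply: (can_inj (scalerK c0)); rewrite -[LHS]triple_left_X Xuv [LHS]triple_left_X.
Qed.

Lemma triple_Y_injective : injective Y.
Proof.
have [bF12 bF43] := triple_left_bij.
have bB : bijective B3 by apply: at2_bij (proj2 (opB_inv R p)).
move=> u v Yuv; apply: (bij_inj bF12); apply: (bij_inj bF43); apply: (bij_inj bB).
have c0 : rt l0.2 != 0 by apply: (rt_neq0 hrt); case/andP: n0.
by apply: (can_inj (scalerK c0)); rewrite -[LHS]triple_left_Y Yuv [LHS]triple_left_Y.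
Qed.

End Left.

Section Right.
Hypotheses (n4 : nonsingular l4) (n5 : nonsingular l5) (n0 : nonsingular l0).
Let F23 := at23_3 (F l2 l3).
Let F15 := at13_3 (F l1 l5).

Let n0' : nonsingular (wmul l1 l5). Proof. by rewrite wmulA. Qed.

Let F23X := at23_X (Fmap_X oddN hrt zeta n2 n3).
Let F23Y := at23_Y (Fmap_Y oddN hrt zeta n2 n3 n5).
Let F23A1 : forall v, F23 (A1 v) = A1 (F23 v) := at23_at11 (F l2 l3) A.
Let F23B1 : forall v, F23 (B1 v) = B1 (F23 v) := at23_at11 (F l2 l3) B.
Let F15X := at13_X (Fmap_X oddN hrt zeta n1 n5).
Let F15Y := at13_Y (Fmap_Y oddN hrt zeta n1 n5 n0').

Lemma triple_right_X v : F15 (F23 (X v)) = rt l0.1 *: A3 (F15 (F23 v)).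
Proof. by rewrite /l0 /l4 -wmulA; exact: (right_X F23X F23A1 F15X). Qed.

Lemma triple_right_Y v : F15 (F23 (Y v)) = rt l0.2 *: B3 (F15 (F23 v)).
Proof. by rewrite /l0 /l4 -wmulA; exact: (right_Y F23X F23Y F23B1 F15Y). Qed.

Lemma triple_right_bij : bijective F23 /\ bijective F15.
Proof.
split; first exact: at23_3_bij (Fmap_bij oddN hrt hzeta n2 n3 n5).
exact: at13_3_bij (Fmap_bij oddN hrt hzeta n1 n5 n0').
Qed.

End Right.
End Triple.

Section Regular.
Variables (R : realType) (p : nat).
Local Notation C := R[i].
Local Notation N := p.+1.
Hypothesis oddN : odd N.
Variable rt : C -> C.
Hypothesis hrt : root_choice p rt.
Variable zeta : C -> C -> C.
Hypothesis hzeta : forall a c : C, c ^+ N - a ^+ N = 1 -> zeta a c != 0.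
Implicit Types l : weight R.

Lemma repV_invertible l : nonsingular l -> acts_invertibly (repV p rt l).
Proof.
case/andP=> x0 y0; split; apply: bij_scale; rewrite ?(rt_neq0 hrt) //.
  exact: opA_bij.
exact: (proj2 (opB_inv R p)).
Qed.

Let pair l l' := rep_tens (repV p rt l) (repV p rt l').
Let triple l l' l'' := rep_tens (pair l l') (repV p rt l'').

Let pairX l l' v : actX (pair l l') v = (rt l.1 * rt l'.1) *: at1 (opA R p) (at2 (opA R p) v).
Proof. exact (tensop_X (opA R p) (opA R p) (rt l.1) (rt l'.1) v). Qed.

Let pairY l l' v : actY (pair l l') v =
  (rt l.2 * rt l'.1) *: at1 (opB R p) (at2 (opA R p) v) + rt l'.2 *: at2 (opB R p) v.
Proof. exact (tensop_Y (opB R p) (opA R p) (opB R p) (rt l.2) (rt l'.1) (rt l'.2) v). Qed.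

Let tripleX l l' l'' v : actX (triple l l' l'') v = (rt l.1 * rt l'.1 * rt l''.1) *:
  at1 (at1 (opA R p)) (at1 (at2 (opA R p)) (at2 (opA R p) v)).
Proof. exact (tensop3_X (opA R p) (opA R p) (opA R p) (rt l.1) (rt l'.1) (rt l''.1) v). Qed.

Let tripleY l l' l'' v : actY (triple l l' l'') v =
  (rt l.2 * rt l'.1 * rt l''.1) *: at1 (at1 (opB R p)) (at1 (at2 (opA R p)) (at2 (opA R p) v)) +
  (rt l'.2 * rt l''.1) *: at1 (at2 (opB R p)) (at2 (opA R p) v) + rt l''.2 *: at2 (opB R p) v.
Proof.
exact (tensop3_Y (opB R p) (opA R p) (opB R p) (opA R p) (opB R p) (rt l.2) (rt l'.1) (rt l'.2) (rt l''.1) (rt l''.2) v).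
Qed.

Lemma pair_invertible l l' : nonsingular l -> nonsingular l' ->
  acts_invertibly (pair l l') <-> nonsingular (wmul l l').
Proof.
move=> n n'; split=> [[_ bY]|nn'].
  apply: (copY_inj oddN hrt n n') => u v uv; apply: (bij_inj bY).
  by rewrite [LHS]pairY [RHS]pairY; move: uv; rewrite [LHS]copYE [RHS]copYE.
split; apply: end_inj_bij => u v.
  by rewrite [LHS]pairX [RHS]pairX; apply: (pair_X_injective oddN hrt hzeta n n' nn').
by rewrite [LHS]pairY [RHS]pairY; apply: (pair_Y_injective oddN hrt hzeta n n' nn').
Qed.

Lemma triple_invertible l l' l'' :
  nonsingular l -> nonsingular l' -> nonsingular l'' -> nonsingular (wmul l l') ->
  acts_invertibly (triple l l' l'') <-> nonsingular (wmul (wmul l l') l'').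
Proof.
move=> n n' n'' nn'; split=> [[_ bY]|n0].
  apply: (triple_Y_inj oddN hrt hzeta n n' n'' nn') => u v uv; apply: (bij_inj bY).
  by rewrite [LHS]tripleY [RHS]tripleY.
split; apply: end_inj_bij => u v.
  rewrite [LHS]tripleX [RHS]tripleX.
  exact: (triple_X_injective oddN hrt hzeta n n' n'' nn' n0).
rewrite [LHS]tripleY [RHS]tripleY.
exact: (triple_Y_injective oddN hrt hzeta n n' n'' nn' n0).
Qed.

Lemma regular3P l l' l'' :
  regular p rt [:: l; l'; l''] <->
  [/\ nonsingular l, nonsingular l' & nonsingular l''] /\
  [/\ nonsingular (wmul l l'), nonsingular (wmul l' l'')
    & nonsingular (wmul (wmul l l') l'')].
Proof.
split=> [[/and4P[n n' n'' _] inv]|[[n n' n''] [nn' n'n'' n0]]].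
  have nn' : nonsingular (wmul l l').
    by apply/(pair_invertible n n')/(inv l [:: l'])/infixP; exists [::], [:: l''].
  do !split=> //.
    by apply/(pair_invertible n' n'')/(inv l' [:: l''])/infixP; exists [:: l], [::].
  apply/(triple_invertible n n' n'' nn')/(inv l [:: l'; l'']).
  by apply/infixP; exists [::], [::].
split=> [|k t]; first by rewrite /= n n' n''.
(* The six bullets are the six segments of a triple, ordered by their starting point; all other
   splittings contain too many weights. *)
case/infixP=> [[|k1 [|k2 [|k3 s1]]] [s2]]; case: t => [|t1 [|t2 [|t3 t]]] //=.
- by case=> <- _; apply: repV_invertible.
- by case=> <- <- _; apply/pair_invertible.
- by case=> <- <- <- _; apply/triple_invertible.
- by case=> _ <- _; apply: repV_invertible.
- by case=> _ <- <- _; apply/pair_invertible.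
- by case=> _ _ <- _; apply: repV_invertible.
all: by case: s1.
Qed.

End Regular.

Section TmapSpec.
Variables (R : realType) (p : nat).
Local Notation C := R[i].
Local Notation N := p.+1.
Local Notation A := (opA R p).
Local Notation B := (opB R p).
Local Notation VV := (vec R ('I_N * 'I_N)%type).

Lemma at21K (I : finType) (T : 'End(vec R (I * I)%type)) : at21 (at21 T) = T.
Proof.
apply/lfunP => v; apply/ffunP => -[i j]; rewrite [LHS]at21E [LHS]at21E.
by congr (T _ _); apply/ffunP => -[a b]; rewrite !ffunE.
Qed.

Lemma at21_bij (I : finType) (T : 'End(vec R (I * I)%type)) :
  bijective T -> bijective (at21 T).
Proof. by apply: leg_bij => [[]|[]|]. Qed.

Hypothesis oddN : odd N.
Variable rt : C -> C.
Hypothesis hrt : root_choice p rt.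
Variable zeta : C -> C -> C.
Hypothesis hzeta : forall a c : C, c ^+ N - a ^+ N = 1 -> zeta a c != 0.
Local Notation F := (Fmap p rt zeta).
Variables l1 l2 l3 : weight R.
Hypothesis hreg : regular p rt [:: l1; l2; l3].
Local Notation l4 := (wmul l1 l2).
Local Notation l5 := (wmul l2 l3).

(** The defining equation of T with the inverses moved to the other side. The point is that [xget]
    has a witness. *)
Lemma Tmap_spec v :
  at13_3 (F l1 l5) (at23_3 (F l2 l3) v) =
  at1 (at21 (Tmap p rt zeta l1 l2 l3)) (at23_3 (F l4 l3) (at12_3 (F l1 l2) v)).
Proof.
have [[n1 n2 n3] [n4 n5 n0]] := (regular3P oddN hrt hzeta l1 l2 l3).1 hreg.
have [bF12 bF43] := triple_left_bij oddN hrt hzeta n1 n2 n3 n4 n0.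
have [bF23 bF15] := triple_right_bij oddN hrt hzeta n1 n2 n3 n5 n0.
rewrite /Tmap; set P := (X in xget 0 X).
pose O := (at13_3 (F l1 l5) \o (at23_3 (F l2 l3) \o
  (at12_3 (F l1 l2)^-1 \o at23_3 (F l4 l3)^-1)))%VF.
pose L w := at23_3 (F l4 l3) (at12_3 (F l1 l2) w).
have OE w : O (L w) = at13_3 (F l1 l5) (at23_3 (F l2 l3) w).
  rewrite /O [LHS]comp_lfun4E /L.
  rewrite (at23_3_inv (Fmap_bij oddN hrt hzeta n4 n3 n0)) (bij_lfunK bF43).
  by rewrite (at12_3_inv (Fmap_bij oddN hrt hzeta n1 n2 n4)) (bij_lfunK bF12).
have L_surj w : exists u, w = L u.
  have [F12' _ F12K] := bF12; have [F43' _ F43K] := bF43.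
  by exists (F12' (F43' w)); rewrite /L F12K F43K.
have [x0 y0] := andP n0.
(* [O] carries one bracketing [L] to the other, and both intertwine the triple action with the same
   scalar multiple of A_3; likewise for B_3. Schur's lemma then removes the third factor. *)
have OA w : O (at2 A w) = at2 A (O w).
  exact: (intertwine_factor (rt_neq0 hrt x0) L_surj
    (triple_left_X oddN hrt zeta n1 n2 n3 n4)
    (triple_right_X oddN hrt zeta n1 n2 n3 n5) OE).
have OB w : O (at2 B w) = at2 B (O w).
  exact: (intertwine_factor (rt_neq0 hrt y0) L_surj
    (triple_left_Y oddN hrt zeta n1 n2 n3 n4 n0)
    (triple_right_Y oddN hrt zeta n1 n2 n3 n5 n0) OE).
have [T OT] := commuting_end_at1 OA OB.
have bT : bijective T.
  have inj1T : injective (at1 T : 'End(vec R ('I_N * 'I_N * 'I_N)%type)).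
    rewrite -OT => w w'; have [u ->] := L_surj w; have [u' ->] := L_surj w'.
    by rewrite [LHS]OE [RHS]OE => /(bij_inj bF15)/(bij_inj bF23) ->.
  by apply: end_inj_bij; apply: (leg_injective _ ((0, 0), 0) inj1T).
have [_ DO] : P (xget 0 P).
  (* The description of T reads the two multiplicity factors in opposite order, so the witness is
     the flipped operator. *)
  apply: (xgetPex 0); exists (at21 T); split; first exact: at21_bij.
  exact: (etrans OT (congr1 (fun Q : 'End(VV) => at1 Q) (esym (at21K T)))).
transitivity (O (L v)); first by rewrite OE.
exact: (congr1 (fun Q : 'End(_) => Q (L v)) DO).
Qed.

End TmapSpec.

(** * The rotation A *)

Section DualWeights.
Variable R : realType.
Implicit Types l : weight R.

Lemma nonsingular_dual l : nonsingular l -> nonsingular (wdual l).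
Proof.
by case/andP=> x0 y0; rewrite /nonsingular /= oppr_eq0 mulf_eq0 invr_eq0 negb_or x0 y0.
Qed.

Lemma wmul_dual l l' : nonsingular l -> nonsingular l' ->
  wmul l' (wdual (wmul l l')) = wdual l.
Proof.
case: l l' => x y [x' y'] /andP[/= x0 y0] /andP[/= x'0 y'0].
by rewrite /wmul /wdual /=; congr (_, _); field; rewrite x0 x'0.
Qed.

End DualWeights.

Section Coordinates.
Variables (R : realType) (p : nat).
Local Notation C := R[i].
Local Notation N := p.+1.
Local Notation e1 := (inZp 1 : 'I_N).
Local Notation chi := (@chi R p).
Variable rt : C -> C.
Variables l l' : weight R.
Local Notation l0 := (wmul l l').

(* H j i m is the coefficient of e_i (x) e_m in the image of e_j. *)
Definition hom_coefs (H : 'I_N -> 'I_N -> 'I_N -> C) : Prop :=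
  (forall j i m, rt l0.1 * chi j * H j i m =
     rt l.1 * rt l'.1 * chi i * chi m * H j i m) /\
  (forall j i m, rt l0.2 * H (j + e1) i m =
     rt l.2 * rt l'.1 * chi m * H j (i - e1) m + rt l'.2 * H j i (m - e1)).

End Coordinates.

Section Rotation.
Variables (R : realType) (p : nat).
Local Notation C := R[i].
Local Notation N := p.+1.
Local Notation e1 := (inZp 1 : 'I_N).
Local Notation chi := (@chi R p).
Hypothesis oddN : odd N.
Variable rt : C -> C.
Hypothesis hrt : root_choice p rt.
Variables l l' : weight R.
Local Notation l0 := (wmul l l').
Hypotheses (n : nonsingular l) (n' : nonsingular l') (n0 : nonsingular l0).

(** A^Hom in coordinates: the first factor becomes the source and the source becomes the last
    factor, both negated by D and C. *)
Definition rotate_coefs (H : 'I_N -> 'I_N -> 'I_N -> C) i m k :=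
  del rt (wdual l) (- i) * gam rt l0 (- k) * H (- k) (- i) m.

Lemma hom_coefs_rotate H :
  hom_coefs rt l l' H -> hom_coefs rt l' (wdual l0) (rotate_coefs H).
Proof.
rewrite /hom_coefs wmul_dual // => -[HX HY].
have [x0 y0] := andP n; have [x'0 y'0] := andP n'; have [xx0 yy0] := andP n0.
have HX' i m k : rt l'.1 * chi (- i) * chi m * chi k * H (- k) (- i) m * rt l.1 =
    rt l0.1 * H (- k) (- i) m.
  have := HX (- k) (- i) m; rewrite [chi (- k)]chiN => HXk.
  transitivity (chi k * (rt l.1 * rt l'.1 * chi (- i) * chi m * H (- k) (- i) m)).
    by ring.
  by rewrite -HXk; field; apply: chi_neq0.
split=> i m k.
  have := HX' i m k; rewrite chiN /= !(rtV hrt) // /rotate_coefs.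
  set d := del _ _ _; set g := gam _ _ _; set h := H _ _ _ => HXk.
  transitivity (d * g * (rt l.1)^-1 * (rt l0.1)^-1 * chi i * (rt l0.1 * h)).
    by field; rewrite ?(rt_neq0 hrt).
  by rewrite -HXk; field; rewrite ?(rt_neq0 hrt) ?chi_neq0.
(* [E1] links the three coefficients that occur in the rotated relation for Y. [E2] trades the
   factor [chi m] of one of them for factors in i and k, and [E3] cancels the root corrections of y
   and y / x. *)
have E1 := HY (- k) (- i) m; rewrite -opprD in E1.
have E2 := HX' (i + e1) m k.
have E3 := mroot_dual hrt x0 y0.
rewrite /= [rt (- _)](rtN hrt) ?mulf_neq0 ?invr_eq0 // (mrootP hrt) ?invr_eq0 // (rtV hrt) //.
rewrite [rt (- _)](rtN hrt) ?mulf_neq0 ?invr_eq0 // (mrootP hrt) ?invr_eq0 //.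
rewrite !(rtV hrt) // /rotate_coefs.
have -> : - (k - e1) = - k + e1 by rewrite opprB addrC.
have -> : del rt (wdual l) (- i) = del rt (wdual l) (- (i + e1) + e1).
  by rewrite opprD subrK.
rewrite (delS oddN) (gamS oddN) [chi (- k)]chiN /= ?invrK.
rewrite /= in E1 E2; move: E1 E2 E3 (rt_neq0 hrt x0) (rt_neq0 hrt xx0) => /=.
move: (chi_neq0 R (mroot p rt (- (l.2 / l.1)) l.1)).
move: (chi_neq0 R (mroot p rt (l.2 * l'.1 + l'.2) (l.1 * l'.1)^-1)).
set M0 := chi _; set M := chi _; set Ml := chi (mroot p rt l.2 l.1^-1).
set h1 := H _ (- (_ + _)) _; set h2 := H _ _ (_ - _); set h3 := H _ _ _.
set rx := rt l.1; set ry := rt l.2; set rxx := rt (l.1 * l'.1); set ryy := rt (_ + _).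
move=> M00 M_0 E1 E2 E3 rx0 rxx0.
have -> : Ml = M^-1 by apply: (mulIf M_0); rewrite E3 mulVf.
set d := del _ _ _; set g := gam _ _ _; set ci := chi (- _); set ck := chi k.
transitivity (M^-1 * ci * d * g * ck / rxx * (rt l'.2 * h2 - ryy * h3)); last first.
  by field; rewrite M00 M_0 rxx0.
rewrite E1 [X in _ - X]addrC opprD addNKr.
transitivity (- (M^-1 * d * g * ry / (rxx * rx)) * (rxx * h1)).
  by field; rewrite M_0 rx0 rxx0.
by rewrite -E2 -/ci -/ck; field; rewrite M_0 rx0 rxx0.
Qed.
End Rotation.

Lemma inv_intertwine (F : fieldType) (W : vectType F) (f P : 'End(W)) (X : W -> W) (c : F) :
  bijective f -> (forall v, f (X v) = c *: P (f v)) ->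
  forall u, X (f^-1%VF u) = c *: f^-1%VF (P u).
Proof.
move=> bf fX u; have /lker0P kerf := bij_inj bf; apply: (bij_inj bf).
by rewrite fX linearZ /= !lker0_lfunVK.
Qed.

Lemma intertwine_eigen (F : fieldType) (W : vectType F) (f P : 'End(W)) (X : W -> W)
    (c d : F) u u' : c != 0 ->
  (forall v, f (X v) = c *: P (f v)) -> X u = c *: (d *: u') -> P (f u) = d *: f u'.
Proof.
move=> c0 fX Xu; apply: (can_inj (scalerK c0)).
by rewrite -fX Xu linearZ /= linearZ.
Qed.

Lemma tensZr (R : realType) (I J : finType) c (u : vec R I) (v : vec R J) :
  tens u (c *: v) = c *: tens u v.
Proof. by apply/ffunP => k; rewrite !ffunE; apply: mulrCA. Qed.

Lemma at2_1 (R : realType) (I J : finType) v :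
  at2 (\1%VF : 'End(vec R J)) v = v :> vec R (I * J)%type.
Proof. by rewrite [at2 _]leg1 ?id_lfunE // => -[]. Qed.

Section ImapCoefs.
Variables (R : realType) (p : nat).
Local Notation C := R[i].
Local Notation N := p.+1.
Local Notation e1 := (inZp 1 : 'I_N).
Local Notation chi := (@chi R p).
Local Notation A := (opA R p).
Local Notation B := (opB R p).
Local Notation V := (vec R 'I_N).
Local Notation VV := (vec R ('I_N * 'I_N)%type).
Hypothesis oddN : odd N.
Variable rt : C -> C.
Hypothesis hrt : root_choice p rt.
Variable zeta : C -> C -> C.
Hypothesis hzeta : forall a c : C, c ^+ N - a ^+ N = 1 -> zeta a c != 0.
Variables l l' : weight R.
Local Notation l0 := (wmul l l').
Hypotheses (n : nonsingular l) (n' : nonsingular l') (n0 : nonsingular l0).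
Local Notation F := (Fmap p rt zeta l l').
Local Notation I_ := (Imap p rt zeta l l').

Let X (v : VV) : VV := (rt l.1 * rt l'.1) *: at1 A (at2 A v).
Let Y (v : VV) : VV :=
  (rt l.2 * rt l'.1) *: at1 B (at2 A v) + rt l'.2 *: at2 B v.

Let XE v i m : X v (i, m) = rt l.1 * rt l'.1 * chi i * chi m * v (i, m).
Proof.
rewrite [LHS]ffunE [at1 _ _ _]at1E [opA _ _ _ _]opAE ffunE [at2 _ _ _]at2E.
by rewrite [opA _ _ _ _]opAE ffunE /GRing.scale /= !mulrA.
Qed.

Let YE v i m : Y v (i, m) =
  rt l.2 * rt l'.1 * chi m * v (i - e1, m) + rt l'.2 * v (i, m - e1).
Proof.
rewrite [LHS]ffunE; congr (_ + _).
  rewrite [LHS]ffunE [at1 _ _ _]at1E [opB _ _ _ _]opBE ffunE [at2 _ _ _]at2E.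
  by rewrite [opA _ _ _ _]opAE ffunE /GRing.scale /= !mulrA.
by rewrite [LHS]ffunE [at2 _ _ _]at2E [opB _ _ _ _]opBE ffunE.
Qed.

Let bF := Fmap_bij oddN hrt hzeta n n' n0.
Let FX : forall v, F (X v) = rt l0.1 *: at2 A (F v) := Fmap_X oddN hrt zeta n n'.
Let FY : forall v, F (Y v) = rt l0.2 *: at2 B (F v) := Fmap_Y oddN hrt zeta n n' n0.

Lemma ImapE f v : I_ f v = F^-1%VF (tens f v).
Proof. by rewrite [I_ f]lfunE [LHS]lfunE. Qed.

Lemma Imap_hom_coefs f :
  hom_coefs rt l l' (fun j i m => I_ f (bas R j) (i, m)).
Proof.
have [bFX bFY] := (inv_intertwine bF FX, inv_intertwine bF FY).
split=> j i m.
  rewrite ImapE -[RHS]XE [X _]bFX at2_tens opA_bas tensZr linearZ /=.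
  by rewrite [RHS]ffunE [X in _ *: X]ffunE /GRing.scale /= mulrA.
rewrite !ImapE -[RHS]YE [Y _]bFY at2_tens opB_bas.
by rewrite [RHS]ffunE.
Qed.

(** After composition with F the map intertwines A and B with A_2 and B_2, so Schur's lemma writes
    it as v |-> f (x) v. *)
Lemma hom_coefs_Imap (h : 'Hom(V, VV)) :
  hom_coefs rt l l' (fun j i m => h (bas R j) (i, m)) -> exists f, h = I_ f.
Proof.
move=> [HX HY]; have [x0 y0] := andP n0.
have hX j : X (h (bas R j)) = rt l0.1 *: (chi j *: h (bas R j)).
  apply/ffunP => -[i m]; rewrite [LHS]XE -[LHS]HX [RHS]ffunE [X in _ *: X]ffunE.
  by rewrite /GRing.scale /= mulrA.
(* The factor 1 gives the relation the same shape as an eigenvalue equation, so [intertwine_eigen]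
   covers both generators. *)
have hY j : Y (h (bas R j)) = rt l0.2 *: (1 *: h (bas R (j + e1))).
  by apply/ffunP => -[i m]; rewrite [LHS]YE -[LHS]HY [RHS]ffunE scale1r.
pose g := (F \o h)%VF.
have gE v : g v = F (h v) by rewrite [LHS]comp_lfunE.
have gA v : g (A v) = at2 A (g v).
  have E : (g \o A = at2 A \o g)%VF.
    apply: hom_eq_bas => j; rewrite [LHS]comp_lfunE [RHS]comp_lfunE opA_bas linearZ /= gE.
    exact: esym (intertwine_eigen (rt_neq0 hrt x0) FX (hX j)).
  by have := congr1 (fun L : 'Hom(V, VV) => L v) E; rewrite /= !comp_lfunE.
have gB v : g (B v) = at2 B (g v).
  have E : (g \o B = at2 B \o g)%VF.
    apply: hom_eq_bas => j; rewrite [LHS]comp_lfunE [RHS]comp_lfunE opB_bas !gE.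
    by rewrite -[LHS]scale1r; exact: esym (intertwine_eigen (rt_neq0 hrt y0) FY (hY j)).
  by have := congr1 (fun L : 'Hom(V, VV) => L v) E; rewrite /= !comp_lfunE.
have [f Hf] := commuting_hom_tens gA gB.
exists f; apply/lfunP => v; rewrite ImapE -Hf gE.
by rewrite (bij_lfunK bF).
Qed.

Lemma tensop2_diag (D E : 'End(V)) (d g : 'I_N -> C) (h : 'Hom(V, VV)) i m k :
  (forall v j, D v j = d j * v (- j)) -> (forall v j, E v j = g j * v (- j)) ->
  tensop (tensop D \1%VF) E (\sum_j tens (h (bas R j)) (bas R j)) (i, m, k) =
  d i * g k * h (bas R (- k)) (- i, m).
Proof.
move=> DE EE; rewrite [tensop _ _ _]tensopE [LHS]at1E [tensop _ _ _]tensopE.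
rewrite [LHS]at1E [LHS]DE ffunE at2_1.
rewrite ffunE [at2 _ _ _]at2E [E _ _]EE ffunE mulrA; congr (_ * _).
rewrite sum_ffunE (bigD1 (- k)) //= big1 => [|j ne_jk].
  by rewrite tensE bas_eq mulr1 addr0.
by rewrite tensE ffunE eq_sym (negPf ne_jk) mulr0.
Qed.

Lemma AHom_coefs (h : 'Hom(V, VV)) i m k : AHom p rt l l' h (bas R i) (m, k) =
  rotate_coefs rt l l' (fun j a b => h (bas R j) (a, b)) i m k.
Proof.
rewrite [AHom _ _ _ _ _]lfunE [X in fun_of_fin X]on_basis_bas ffunE /=.
exact: (tensop2_diag h i m k (opDE rt (wdual l)) (opCE rt l0)).
Qed.

End ImapCoefs.

Section AmapSpec.
Variables (R : realType) (p : nat).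
Local Notation C := R[i].
Local Notation N := p.+1.
Hypothesis oddN : odd N.
Variable rt : C -> C.
Hypothesis hrt : root_choice p rt.
Variable zeta : C -> C -> C.
Hypothesis hzeta : forall a c : C, c ^+ N - a ^+ N = 1 -> zeta a c != 0.
Variables l l' : weight R.
Local Notation l0 := (wmul l l').
Hypotheses (n : nonsingular l) (n' : nonsingular l') (n0 : nonsingular l0).

(** The generalized inverse in [Amap] is a right inverse only on the image of [Imap]; the rotated
    coefficients satisfy the homomorphism relations, so the argument lies there. *)
Lemma Amap_spec f : Imap p rt zeta l' (wdual l0) (Amap p rt zeta l l' f) =
  AHom p rt l l' (Imap p rt zeta l l' f).
Proof.
have nd0 := nonsingular_dual n0.
have nd : nonsingular (wmul l' (wdual l0)) by rewrite wmul_dual // nonsingular_dual.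
have [f' Hf'] : exists f', AHom p rt l l' (Imap p rt zeta l l' f) =
    Imap p rt zeta l' (wdual l0) f'.
  apply: (hom_coefs_Imap oddN hrt hzeta n' nd0 nd).
  have := hom_coefs_rotate oddN hrt n n' n0 (Imap_hom_coefs oddN hrt hzeta n n' n0 f).
  congr (hom_coefs _ _ _ _); apply/funext => j; apply/funext => i; apply/funext => m.
  by rewrite AHom_coefs.
rewrite [Amap _ _ _ _ _ _]comp_lfunE [X in _^-1%VF X]comp_lfunE Hf'.
by rewrite limg_lfunVK // memv_img ?memvf.
Qed.

End AmapSpec.

(** * The pentagon *)

Section Sums.
Variables (K : comPzRingType) (I : finType) (w p : I -> K) (A q : I -> I -> K).

(** Moves a matrix [A] from the coefficients of the tensor onto the homomorphism that they
    multiply. *)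
Lemma sum_substr :
  \sum_b (\sum_c w c * A c b) * (\sum_m p m * q b m) =
  \sum_c w c * \sum_m p m * \sum_b A c b * q b m.
Proof.
under eq_bigr do rewrite mulr_suml; rewrite exchange_big; apply: eq_bigr => c _ /=.
under eq_bigr do rewrite -mulrA; rewrite -mulr_sumr; congr (_ * _).
under eq_bigr do rewrite mulr_sumr; rewrite exchange_big; apply: eq_bigr => m _ /=.
by rewrite mulr_sumr; apply: eq_bigr => b _; rewrite mulrCA.
Qed.

Lemma sum_substl :
  \sum_b (\sum_c w c * A c b) * (\sum_m q b m * p m) =
  \sum_c w c * \sum_m (\sum_b A c b * q b m) * p m.
Proof.
under eq_bigr do under [X in _ * X]eq_bigr do rewrite mulrC.
by rewrite sum_substr; under eq_bigr do under eq_bigr do rewrite mulrC.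
Qed.

End Sums.

Section Compose.
Variables (R : realType) (I : finType).
Local Notation C := R[i].
Local Notation V := (vec R I).
Local Notation VV := (vec R (I * I)%type).
Local Notation W := (vec R (I * I * I)%type).
Implicit Types (P Q : 'Hom(V, 'Hom(V, VV))) (w t : VV) (e : V).

(* For w = f (x) g, these are (P f (x) id) (Q g e) and (id (x) Q g) (P f e). *)
Definition comp12 P Q w e : W := [ffun k => \sum_a \sum_b w (a, b) *
  \sum_m Q (bas R b) e (m, k.2) * P (bas R a) (bas R m) (k.1.1, k.1.2) : C].
Definition comp23 P Q w e : W := [ffun k => \sum_a \sum_b w (a, b) *
  \sum_m P (bas R a) e (k.1.1, m) * Q (bas R b) (bas R m) (k.1.2, k.2) : C].

Lemma sum_mul_bas (f : I -> C) i : \sum_a f a * (bas R a) i = f i.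
Proof.
rewrite (bigD1 i) //= big1 => [|a ne_ai]; first by rewrite bas_eq mulr1 addr0.
by rewrite ffunE eq_sym (negPf ne_ai) mulr0.
Qed.

Lemma hom_sum3 (J : finType) (F : 'End(vec R J)) (c : I -> I -> C) (d : I -> I -> I -> C)
    (u : I -> I -> I -> vec R J) k :
  F [ffun j => \sum_a \sum_b c a b * \sum_m d a b m * u a b m j] k =
  \sum_a \sum_b c a b * \sum_m d a b m * F (u a b m) k.
Proof.
rewrite (_ : [ffun j => _] =
    \sum_a \sum_b c a b *: \sum_m d a b m *: u a b m); last first.
  apply/ffunP => j; rewrite [LHS]ffunE sum_ffunE; apply: eq_bigr => a _.
  rewrite sum_ffunE; apply: eq_bigr => b _; rewrite [RHS]ffunE sum_ffunE.
  congr (_ * _); apply: eq_bigr => m _; by rewrite [RHS]ffunE.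
rewrite linear_sum sum_ffunE; apply: eq_bigr => a _.
rewrite linear_sum sum_ffunE; apply: eq_bigr => b _.
rewrite linearZ [LHS]ffunE linear_sum sum_ffunE; congr (_ * _).
by apply: eq_bigr => m _; rewrite linearZ [LHS]ffunE.
Qed.

Lemma hom_sum1 (J : finType) (F : 'End(vec R J)) (c : I -> C) (u : I -> vec R J) k :
  F [ffun j => \sum_a c a * u a j] k = \sum_a c a * F (u a) k.
Proof.
rewrite (_ : [ffun j => _] = \sum_a c a *: u a); last first.
  apply/ffunP => j; rewrite [LHS]ffunE sum_ffunE; apply: eq_bigr => a _.
  by rewrite [RHS]ffunE.
rewrite linear_sum sum_ffunE; apply: eq_bigr => a _.
by rewrite linearZ [LHS]ffunE.
Qed.

Section Unfold.
Variables (F G : 'End(VV)) (P Q : 'Hom(V, 'Hom(V, VV))).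
Hypothesis FP : forall f v, F (P f v) = tens f v.
Hypothesis GQ : forall f v, G (Q f v) = tens f v.

(** F_12 strips off P and exposes its argument, the first leg of Q; G then strips off Q. The two
    factors freed in this way hold w. *)
Lemma comp12_unfold w e : at23_3 G (at12_3 F (comp12 P Q w e)) = tens w e.
Proof.
apply/ffunP => -[[x y] z]; rewrite [LHS]at23E [RHS]tensE.
have E12 b c : at12_3 F (comp12 P Q w e) (x, b, c) =
    \sum_g w (x, g) * Q (bas R g) e (b, c).
  rewrite [LHS]at1E.
  rewrite (_ : [ffun _ => _] = [ffun ab => \sum_a \sum_b w (a, b) *
    \sum_m Q (bas R b) e (m, c) * P (bas R a) (bas R m) ab]); last first.
    by apply/ffunP => -[i j]; rewrite !ffunE.
  rewrite [LHS](hom_sum3 F (fun a b => w (a, b)) (fun a b m => Q (bas R b) e (m, c))).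
  rewrite exchange_big; apply: eq_bigr => g _ /=.
  rewrite -[RHS](sum_mul_bas (fun a => w (a, g) * Q (bas R g) e (b, c))).
  apply: eq_bigr => a _; rewrite -mulrA; congr (_ * _).
  rewrite -[RHS](sum_mul_bas (fun m => Q (bas R g) e (m, c) * bas R a x)).
  by apply: eq_bigr => m _; rewrite FP tensE mulrA.
rewrite (_ : [ffun _ => _] = [ffun bc => \sum_g w (x, g) * Q (bas R g) e bc]); last first.
  by apply/ffunP => -[b c]; rewrite [LHS]ffunE [RHS]ffunE; apply: E12.
rewrite [LHS](hom_sum1 G (fun g => w (x, g))).
rewrite -[RHS](sum_mul_bas (fun g => w (x, g) * e z)).
by apply: eq_bigr => g _; rewrite GQ tensE [bas R g y * _]mulrC mulrA.
Qed.

Lemma comp23_unfold w e : at13_3 F (at23_3 G (comp23 P Q w e)) = tens w e.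
Proof.
apply/ffunP => -[[x y] z]; rewrite [LHS]at13E [RHS]tensE.
have E23 i c : at23_3 G (comp23 P Q w e) (i, y, c) =
    \sum_g w (g, y) * P (bas R g) e (i, c).
  rewrite [LHS]at23E.
  rewrite (_ : [ffun _ => _] = [ffun bc => \sum_a \sum_b w (a, b) *
    \sum_m P (bas R a) e (i, m) * Q (bas R b) (bas R m) bc]); last first.
    by apply/ffunP => -[b d]; rewrite !ffunE.
  rewrite [LHS](hom_sum3 G (fun a b => w (a, b)) (fun a b m => P (bas R a) e (i, m))).
  apply: eq_bigr => g _ /=.
  rewrite -[RHS](sum_mul_bas (fun b => w (g, b) * P (bas R g) e (i, c))).
  apply: eq_bigr => b _; rewrite -mulrA; congr (_ * _).
  rewrite -[RHS](sum_mul_bas (fun m => P (bas R g) e (i, m) * bas R b y)).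
  by apply: eq_bigr => m _; rewrite GQ tensE mulrA.
rewrite (_ : [ffun _ => _] = [ffun ac => \sum_g w (g, y) * P (bas R g) e ac]); last first.
  by apply/ffunP => -[b c]; rewrite [LHS]ffunE [RHS]ffunE; apply: E23.
rewrite [LHS](hom_sum1 F (fun g => w (g, y))).
rewrite -[RHS](sum_mul_bas (fun g => w (g, y) * e z)).
by apply: eq_bigr => g _; rewrite FP tensE [bas R g x * _]mulrC mulrA.
Qed.
End Unfold.

Lemma comp23_inj (F G : 'End(VV)) P Q w w' (i0 : I) :
  (forall f v, F (P f v) = tens f v) -> (forall f v, G (Q f v) = tens f v) ->
  (forall i, comp23 P Q w (bas R i) = comp23 P Q w' (bas R i)) -> w = w'.
Proof.
move=> FP GQ eq_ww'; apply/ffunP => k.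
have := congr1 (fun u => at13_3 F (at23_3 G u) (k, i0)) (eq_ww' i0).
by rewrite /= !(comp23_unfold FP GQ) !tensE bas_eq !mulr1.
Qed.

Lemma hom_comp_coord (P : 'Hom(V, 'Hom(V, VV))) (A : 'End(V)) i v k :
  P (A (bas R i)) v k = \sum_j A (bas R i) j * P (bas R j) v k.
Proof.
rewrite {1}[A (bas R i)]vec_sum_bas linear_sum sum_lfunE sum_ffunE.
by apply: eq_bigr => j _; rewrite linearZ scale_lfunE [LHS]ffunE.
Qed.

Lemma at1_coord (A : 'End(V)) w a b :
  at1 A w (a, b) = \sum_c w (c, b) * A (bas R c) a.
Proof. by rewrite at1E hom_coord; apply: eq_bigr => c _; rewrite ffunE. Qed.

Lemma at2_coord (A : 'End(V)) w a b :
  at2 A w (a, b) = \sum_c w (a, c) * A (bas R c) b.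
Proof. by rewrite at2E hom_coord; apply: eq_bigr => c _; rewrite ffunE. Qed.

Lemma comp23_at2 P Q (A : 'End(V)) w e :
  comp23 P Q (at2 A w) e = comp23 P (Q \o A)%VF w e.
Proof.
apply/ffunP => -[[x y] z]; rewrite [LHS]ffunE [RHS]ffunE /=.
apply: eq_bigr => a _; under eq_bigr do rewrite at2_coord.
rewrite [LHS](sum_substr (fun c => w (a, c)) (fun m => P (bas R a) e (x, m))
  (fun c b => A (bas R c) b) (fun b m => Q (bas R b) (bas R m) (y, z))).
apply: eq_bigr => c _; congr (_ * _); apply: eq_bigr => m _; congr (_ * _).
by rewrite [(Q \o A)%VF _]comp_lfunE hom_comp_coord.
Qed.

Lemma comp23_at1 P Q (A : 'End(V)) w e :
  comp23 P Q (at1 A w) e = comp23 (P \o A)%VF Q w e.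
Proof.
apply/ffunP => -[[x y] z]; rewrite [LHS]ffunE [RHS]ffunE /=.
rewrite exchange_big [RHS]exchange_big; apply: eq_bigr => b _ /=.
under eq_bigr do rewrite at1_coord.
rewrite [LHS](sum_substl (fun c => w (c, b)) (fun m => Q (bas R b) (bas R m) (y, z))
  (fun c a => A (bas R c) a) (fun a m => P (bas R a) e (x, m))).
apply: eq_bigr => c _; congr (_ * _); apply: eq_bigr => m _; congr (_ * _).
by rewrite [(P \o A)%VF _]comp_lfunE hom_comp_coord.
Qed.

Lemma comp12_at2 P Q (A : 'End(V)) w e :
  comp12 P Q (at2 A w) e = comp12 P (Q \o A)%VF w e.
Proof.
apply/ffunP => -[[x y] z]; rewrite [LHS]ffunE [RHS]ffunE /=.
apply: eq_bigr => a _; under eq_bigr do rewrite at2_coord.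
rewrite [LHS](sum_substl (fun c => w (a, c)) (fun m => P (bas R a) (bas R m) (x, y))
  (fun c b => A (bas R c) b) (fun b m => Q (bas R b) e (m, z))).
apply: eq_bigr => c _; congr (_ * _); apply: eq_bigr => m _; congr (_ * _).
by rewrite [(Q \o A)%VF _]comp_lfunE hom_comp_coord.
Qed.

Lemma swap_at1 (A : 'End(V)) w : swap R I (at1 A w) = at2 A (swap R I w).
Proof.
apply/ffunP => -[a b]; rewrite [LHS]swapE at1_coord at2_coord.
by apply: eq_bigr => c _; rewrite swapE.
Qed.

Lemma at21_swap (O : 'End(VV)) w : at21 O (swap R I w) = swap R I (O w).
Proof.
apply/ffunP => -[a b]; rewrite [LHS]at21E [RHS]swapE; congr (O _ _).
by apply/ffunP => -[i j]; rewrite ffunE swapE.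
Qed.

Lemma swapK w : swap R I (swap R I w) = w.
Proof. by apply/ffunP => -[a b]; rewrite !swapE. Qed.

Lemma swap_at2 (A : 'End(V)) w : swap R I (at2 A w) = at1 A (swap R I w).
Proof. by rewrite -[RHS]swapK [in RHS]swap_at1 swapK. Qed.

End Compose.

Lemma mulr_sum3 (K : comPzRingType) (I : finType) (k : K) (c : I -> I -> K)
    (d : I -> I -> I -> K) :
  k * (\sum_a \sum_b c a b * \sum_m d a b m) =
  \sum_a \sum_b c a b * \sum_m k * d a b m.
Proof.
rewrite mulr_sumr; apply: eq_bigr => a _; rewrite mulr_sumr; apply: eq_bigr => b _.
by rewrite mulrCA; congr (_ * _); rewrite mulr_sumr.
Qed.

Section Pentagon.
Variables (R : realType) (p : nat).
Local Notation C := R[i].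
Local Notation N := p.+1.
Local Notation V := (vec R 'I_N).
Local Notation VV := (vec R ('I_N * 'I_N)%type).
Hypothesis oddN : odd N.
Variable rt : C -> C.
Hypothesis hrt : root_choice p rt.
Variable zeta : C -> C -> C.
Hypothesis hzeta : forall a c : C, c ^+ N - a ^+ N = 1 -> zeta a c != 0.
Local Notation F := (Fmap p rt zeta).
Local Notation Im := (Imap p rt zeta).
Local Notation Am := (Amap p rt zeta).
Local Notation T := (Tmap p rt zeta).

Lemma Fmap_Imap l l' : nonsingular l -> nonsingular l' -> nonsingular (wmul l l') ->
  forall f v, F l l' (Im l l' f v) = tens f v.
Proof.
by move=> n n' n0 f v; rewrite ImapE (bij_lfunVK (Fmap_bij oddN hrt hzeta n n' n0)).
Qed.

(** The injective composite of F_23 and F_15 sends both sides to T_21 w (x) e: the right by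
    [comp23_unfold], the left after [Tmap_spec] has exchanged the bracketing. *)
Lemma Tmap_comp l1 l2 l3 (w : VV) (e : V) : regular p rt [:: l1; l2; l3] ->
  comp12 (Im l1 l2) (Im (wmul l1 l2) l3) w e =
  comp23 (Im l1 (wmul l2 l3)) (Im l2 l3) (at21 (T l1 l2 l3) w) e.
Proof.
move=> hreg; have [[n1 n2 n3] [n4 n5 n0]] := (regular3P oddN hrt hzeta l1 l2 l3).1 hreg.
have [bF23 bF15] := triple_right_bij oddN hrt hzeta n1 n2 n3 n5 n0.
have n0' : nonsingular (wmul l1 (wmul l2 l3)) by rewrite wmulA.
apply: (bij_inj bF23); apply: (bij_inj bF15).
rewrite [LHS](Tmap_spec oddN hrt hzeta hreg).
rewrite (comp12_unfold (Fmap_Imap n1 n2 n4) (Fmap_Imap n4 n3 n0)) at1_tens.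
by rewrite (comp23_unfold (Fmap_Imap n1 n5 n0') (Fmap_Imap n2 n3 n5)).
Qed.

Lemma Amap_coefs l l' f i m k :
  nonsingular l -> nonsingular l' -> nonsingular (wmul l l') ->
  Im l' (wdual (wmul l l')) (Am l l' f) (bas R i) (m, k) =
  del rt (wdual l) (- i) * gam rt (wmul l l') (- k) *
  Im l l' f (bas R (- k)) (- i, m).
Proof.
move=> n n' n0; rewrite -[RHS](AHom_coefs rt l l').
by rewrite -(Amap_spec oddN hrt hzeta n n' n0).
Qed.

Variables l1 l2 l3 : weight R.
Hypothesis hreg : regular p rt [:: l1; l2; l3].
Let l4 := wmul l1 l2.
Let l5 := wmul l2 l3.
Let l0 := wmul l4 l3.

Let nonsing : [/\ nonsingular l1, nonsingular l2 & nonsingular l3] /\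
  [/\ nonsingular l4, nonsingular l5 & nonsingular l0].
Proof. exact: (regular3P oddN hrt hzeta l1 l2 l3).1 hreg. Qed.

Lemma wmul_3_dual : wmul l3 (wdual l0) = wdual l4.
Proof. by have [[n1 n2 n3] [n4 n5 n0]] := nonsing; apply: wmul_dual. Qed.

Lemma wmul_5_dual : wmul l5 (wdual l0) = wdual l1.
Proof.
by have [[n1 n2 n3] [n4 n5 n0]] := nonsing; rewrite /l0 /l4 -wmulA wmul_dual.
Qed.

Lemma regular_dual : regular p rt [:: l2; l3; wdual l0].
Proof.
have [[n1 n2 n3] [n4 n5 n0]] := nonsing; apply/(regular3P oddN hrt hzeta).
split; split; rewrite ?wmul_3_dual -?/l5 ?wmul_5_dual //; exact: nonsingular_dual.
Qed.

(** Only the outer homomorphism meets the source and the first factor, so the inner one is left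
    alone. The outer one is the first argument of [comp23] but the second of [comp12], hence the
    [swap]. *)
Lemma comp_rotate12 (t : VV) i :
  comp12 (Im l2 l3) (Im l5 (wdual l0) \o Am l1 l5)%VF (swap R 'I_N t) (bas R i) =
  [ffun k => del rt (wdual l1) (- i) * gam rt l0 (- k.2) *
     comp23 (Im l1 l5) (Im l2 l3) t (bas R (- k.2)) (- i, k.1.1, k.1.2)].
Proof.
have [[n1 n2 n3] [n4 n5 n0]] := nonsing.
have n0' : nonsingular (wmul l1 l5) by rewrite wmulA.
apply/ffunP => -[[b c] n]; rewrite [LHS]ffunE [RHS]ffunE [X in _ * X]ffunE /=.
rewrite [RHS]mulr_sum3 [LHS]exchange_big /=.
apply: eq_bigr => a _; apply: eq_bigr => d _; rewrite swapE; congr (_ * _).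
apply: eq_bigr => m _; rewrite mulrA; congr (_ * _).
rewrite [(_ \o _)%VF _]comp_lfunE /l0 /l4 -wmulA.
by rewrite [LHS]Amap_coefs.
Qed.

Lemma comp_rotate23 (w : VV) i :
  comp23 (Im l2 (wdual l4) \o Am l1 l2)%VF (Im l3 (wdual l0) \o Am l4 l3)%VF w (bas R i) =
  [ffun k => del rt (wdual l1) (- i) * gam rt l0 (- k.2) *
     comp12 (Im l1 l2) (Im l4 l3) w (bas R (- k.2)) (- i, k.1.1, k.1.2)].
Proof.
have [[n1 n2 n3] [n4 n5 n0]] := nonsing; have [x4 y4] := andP n4.
apply/ffunP => -[[b c] n]; rewrite [LHS]ffunE [RHS]ffunE [X in _ * X]ffunE /=.
rewrite [RHS]mulr_sum3.
apply: eq_bigr => a _; apply: eq_bigr => d _; congr (_ * _).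
(* Here both homomorphisms are rotated, and each rotation negates the index of [l4] over which they
   are contracted. *)
rewrite [RHS](reindex_inj (@oppr_inj _)) /=; apply: eq_bigr => m _.
rewrite [X in X * _](_ : _ = Im l2 (wdual l4) (Am l1 l2 (bas R a)) (bas R i) (b, m));
  last by rewrite [(_ \o _)%VF _]comp_lfunE.
rewrite [X in _ * X](_ : _ = Im l3 (wdual l0) (Am l4 l3 (bas R d)) (bas R m) (c, n));
  last by rewrite [(_ \o _)%VF _]comp_lfunE.
rewrite [X in X * _]Amap_coefs // [X in _ * X]Amap_coefs //.
have gd := gam_del hrt (- m) x4 y4.
transitivity (gam rt l4 (- m) * del rt (wdual l4) (- m) *
  (del rt (wdual l1) (- i) * gam rt l0 (- n) *
   (Im l4 l3 (bas R d) (bas R (- n)) (- m, c) * Im l1 l2 (bas R a) (bas R (- m)) (- i, b)))).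
  by rewrite -/l4 -/l0; ring.
by rewrite gd mul1r.
Qed.

Lemma pentagon : (T l2 l3 (wdual l0) \o (at1 (Am l1 l5) \o at21 (T l1 l2 l3)) =
  at1 (Am l4 l3) \o (at2 (Am l1 l2) \o swap R 'I_N))%VF.
Proof.
have [[n1 n2 n3] [n4 n5 n0]] := nonsing.
have [[_ _ nd0] [_ nd4 nd1]] := (regular3P oddN hrt hzeta _ _ _).1 regular_dual.
have nd1' : nonsingular (wmul l2 (wdual l4)).
  by rewrite wmul_dual // nonsingular_dual.
have nd4' := nonsingular_dual n4.
apply/lfunP => w.
transitivity (T l2 l3 (wdual l0) (at1 (Am l1 l5) (at21 (T l1 l2 l3) w))).
  by rewrite [LHS]comp_lfunE; congr (T _ _ _ _); rewrite [LHS]comp_lfunE.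
transitivity (at1 (Am l4 l3) (at2 (Am l1 l2) (swap R 'I_N w))); last first.
  by apply: esym; rewrite [LHS]comp_lfunE; congr (at1 _ _); rewrite [LHS]comp_lfunE.
(* Exchanging the two factors on both sides puts the outer T into the form [at21 T] in which
   [Tmap_comp] speaks of it. *)
rewrite -[LHS]swapK -[RHS]swapK; congr (swap _ _ _).
rewrite -[LHS]at21_swap [X in at21 _ X]swap_at1 [RHS]swap_at1.
transitivity (at2 (Am l4 l3) (at1 (Am l1 l2) w)); last first.
  by apply: (congr1 (at2 (Am l4 l3))); rewrite [RHS]swap_at2 swapK.
(* Both sides are compared as homomorphisms out of the module of [wdual l1], on its basis
   vectors. *)
apply: (@comp23_inj _ _ (F l2 (wdual l4)) (F l3 (wdual l0))
  (Im l2 (wdual l4)) (Im l3 (wdual l0)) _ _ 0).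
- exact: Fmap_Imap.
- exact: Fmap_Imap.
move=> i; rewrite [RHS]comp23_at2 [RHS]comp23_at1 [RHS]comp_rotate23.
(* The T of the dual triple turns [comp23] into [comp12], which is a rotation of the [comp23] of the
   original triple; the first T then identifies that with the [comp12] on the right. *)
have := Tmap_comp (at2 (Am l1 l5) (swap R 'I_N (at21 (T l1 l2 l3) w))) (bas R i) regular_dual.
rewrite wmul_3_dual => <-.
rewrite [LHS]comp12_at2 [LHS]comp_rotate12.
apply/ffunP => k; rewrite [LHS]ffunE [RHS]ffunE; congr (_ * _).
by rewrite [in RHS](Tmap_comp _ _ hreg).
Qed.

End Pentagon.

Theorem proposition5p6 (R : realType) (p : nat) (hN : odd p.+1)
  (rt : R[i] -> R[i]) (hrt : root_choice p rt)
  (zeta : R[i] -> R[i] -> R[i])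
  (hzeta : forall a c : R[i], c ^+ p.+1 - a ^+ p.+1 = 1 -> zeta a c != 0)
  (l1 l2 l3 : weight R) (hreg : regular p rt [:: l1; l2; l3]) :
  let l0 := wmul (wmul l1 l2) l3 in
  let l4 := wmul l1 l2 in
  let l5 := wmul l2 l3 in
  let T := Tmap p rt zeta in
  let A := Amap p rt zeta in
  [/\ regular p rt [:: l2; l3; wdual l0],
      wmul l2 l3 = l5,
      wmul l3 (wdual l0) = wdual l4,
      wmul (wmul l2 l3) (wdual l0) = wdual l1 &
      (T l2 l3 (wdual l0) \o (at1 (A l1 l5) \o at21 (T l1 l2 l3)) =
       at1 (A l4 l3) \o (at2 (A l1 l2) \o swap R 'I_p.+1))%VF].
Proof.
move=> l0 l4 l5 T A; split.
- exact: (regular_dual hN hrt hzeta hreg).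
- by [].
- exact: (wmul_3_dual hN hrt hzeta hreg).
- exact: (wmul_5_dual hN hrt hzeta hreg).
exact: (pentagon hN hrt hzeta hreg).
Qed.
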